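(* Let $\Gamma$ be a discrete group acting by homeomorphisms on a locally compact Hausdorff space $X$, and let $\mathcal{G}=\Gamma\ltimes X$ be the corresponding transformation groupoid. Then for every $x\in X$ the norm $\lVert\cdot\rVert_e$ on $\mathbb{C}\mathcal{G}^x_x\cong\mathbb{C}\Gamma_x$ coincides with the reduced norm, where $\Gamma_x$ is the stabilizer of $x$.
   Context: Transformation groupoid: $\Gamma\ltimes X$ is the set $\Gamma\times X$ with the product topology and product $(g,hx)(h,x)=(gh,x)$, so that $r(g,x)=gx$, $s(g,x)=x$, $(g,x)^{-1}=(g^{-1},gx)$ (the unit space $\{e\}\times X$ being identified with $X$). It is a locally compact Hausdorff étale groupoid, and $\mathcal{G}^x_x=\Gamma_x\times\{x\}\cong\Gamma_x$. For a locally compact étale groupoid $\mathcal{G}$ put $\mathcal{G}_x=s^{-1}(x)$, $\mathcal{G}^x=r^{-1}(x)$, $\mathcal{G}^x_x=\mathcal{G}^x\cap\mathcal{G}_x$ (the isotropy group, discrete). For $\mathcal{G}$ Hausdorff, $C_c(\mathcal{G})$ is the space of continuous compactly supported functions, a $*$-algebra with $(f_1*f_2)(g)=\sum_{h\in\mathcal{G}^{r(g)}}f_1(h)f_2(h^{-1}g)$ and $f^*(g)=\overline{f(g^{-1})}$. $C^*(\mathcal{G})$ is its completion in the norm $\sup_\rho\lVert\rho(f)\rVert$ over all representations by bounded operators on Hilbert spaces. $C^*_r(\mathcal{G})$ is its completion in the reduced norm $\lVert f\rVert_r=\sup_{y\in\mathcal{G}^{(0)}}\lVert\rho_y(f)\rVert$,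 where $\rho_y(f)\delta_g=\sum_{h\in\mathcal{G}_{r(g)}}f(h)\delta_{hg}$ on $\ell^2(\mathcal{G}_y)$. A representation of $C^*(\mathcal{G})$ factors through $C^*_r(\mathcal{G})$ if it vanishes on the kernel of the canonical surjection $C^*(\mathcal{G})\to C^*_r(\mathcal{G})$. Induction: let $\rho\colon C^*(\mathcal{G}^x_x)\to B(H)$ be a representation of the full group C$^*$-algebra with canonical unitaries $u_g$. Let $L$ be the Hilbert space of functions $\xi\colon\mathcal{G}_x\to H$ with $\xi(gh)=\rho(u_h^* )\xi(g)$ for $g\in\mathcal{G}_x$, $h\in\mathcal{G}^x_x$, and $\sum_{g\in\mathcal{G}_x/\mathcal{G}^x_x}\lVert\xi(g)\rVert^2<\infty$. Then $\operatorname{Ind}\rho\colon C^*(\mathcal{G})\to B(L)$ is given by $((\operatorname{Ind}\rho)(f)\xi)(g)=\sum_{h\in\mathcal{G}^{r(g)}}f(h)\xi(h^{-1}g)$ for $f\in C_c(\mathcal{G})$. Norms on the group algebra $\mathbb{C}\mathcal{G}^x_x=C_c(\mathcal{G}^x_x)$: $\lVert h\rVert_e=\sup_\rho\lVert\rho(h)\rVert$, the supremum over all representations $\rho$ of $C^*(\mathcal{G}^x_x)$ such that $\operatorname{Ind}\rho$ factors through $C^*_r(\mathcal{G})$ (this is a C$^*$-norm); the reduced norm on $\mathbb{C}\mathcal{G}^x_x$ is the norm of the reduced group C$^*$-algebra. *)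

(* Defs.v *)
From HB Require Import structures.
From mathcomp Require Import all_boot all_order all_algebra complex.
From mathcomp Require Import all_classical all_reals all_analysis.

Set Implicit Arguments.
Unset Strict Implicit.
Unset Printing Implicit Defensive.

Import Order.TTheory GRing.Theory Num.Theory.
Import numFieldNormedType.Exports.

Local Open Scope classical_set_scope.
Local Open Scope ring_scope.

(* [gmul g h] is meaningful only when [src g = tgt h]; its value is
   unconstrained otherwise.  The unit space is a separate type [obj], embedded
   in [arr] by [idm]; as [idm] and [src] are continuous, the topology of [obj]
   is the one induced by [arr]. *)
Record etale_groupoid := EtaleGroupoid {
  arr : topologicalType;
  obj : topologicalType;
  src : arr -> obj;
  tgt : arr -> obj;
  idm : obj -> arr;
  gmul : arr -> arr -> arr;
  ginv : arr -> arr;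
  src_idm : forall x, src (idm x) = x;
  tgt_idm : forall x, tgt (idm x) = x;
  src_gmul : forall g h, src g = tgt h -> src (gmul g h) = src h;
  tgt_gmul : forall g h, src g = tgt h -> tgt (gmul g h) = tgt g;
  gmulA : forall g h k, src g = tgt h -> src h = tgt k ->
    gmul g (gmul h k) = gmul (gmul g h) k;
  gmul_idl : forall g, gmul (idm (tgt g)) g = g;
  gmul_idr : forall g, gmul g (idm (src g)) = g;
  src_ginv : forall g, src (ginv g) = tgt g;
  tgt_ginv : forall g, tgt (ginv g) = src g;
  gmulVl : forall g, gmul (ginv g) g = idm (src g);
  gmulVr : forall g, gmul g (ginv g) = idm (tgt g);
  src_cont : continuous src;
  tgt_cont : continuous tgt;
  idm_cont : continuous idm;
  ginv_cont : continuous ginv;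
  gmul_cont : {within [set p : arr * arr | src p.1 = tgt p.2],
                continuous (fun p : arr * arr => gmul p.1 p.2)};
  arr_hausdorff : hausdorff_space arr;
  arr_locally_compact : locally_compact [set: arr];
  (* [src], hence also [tgt], is a local homeomorphism *)
  src_etale : forall g, exists U : set arr,
    [/\ open U, U g, set_inj U src &
        forall V, V `<=` U -> open V -> open (src @` V)]
}.

Section Isotropy.
Context (G : etale_groupoid) (x : obj G).

Definition isotropy_set : set (arr G) := [set g | src g = x /\ tgt g = x].
Definition isotropy : Type := set_type isotropy_set.

HB.instance Definition _ := Choice.on isotropy.

Lemma isotropyP (g : isotropy) : src (\val g) = x /\ tgt (\val g) = x.
Proof. by case: g => g /= /set_mem. Qed.

Definition isotropy_of g (gs : src g = x) (gt : tgt g = x) : isotropy :=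
  @SigSub _ _ _ g (mem_set (conj gs gt : isotropy_set g)).

Lemma isotropy_mul_comp (g h : isotropy) : src (\val g) = tgt (\val h).
Proof. by rewrite (isotropyP g).1 (isotropyP h).2. Qed.

Definition isotropy_one : isotropy := isotropy_of (src_idm x) (tgt_idm x).
Definition isotropy_mul (g h : isotropy) : isotropy :=
  isotropy_of
    (etrans (src_gmul (isotropy_mul_comp g h)) (isotropyP h).1)
    (etrans (tgt_gmul (isotropy_mul_comp g h)) (isotropyP g).2).
Definition isotropy_inv (g : isotropy) : isotropy :=
  isotropy_of (etrans (src_ginv _) (isotropyP g).2)
              (etrans (tgt_ginv _) (isotropyP g).1).

Lemma isotropy_mulA : associative isotropy_mul.
Proof.
by move=> g h k; apply/val_inj; apply: gmulA; exact: isotropy_mul_comp.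
Qed.
Lemma isotropy_mul1g : left_id isotropy_one isotropy_mul.
Proof.
by move=> g; apply/val_inj; rewrite /= -[in idm x](isotropyP g).2 gmul_idl.
Qed.
Lemma isotropy_mulg1 : right_id isotropy_one isotropy_mul.
Proof.
by move=> g; apply/val_inj; rewrite /= -[in idm x](isotropyP g).1 gmul_idr.
Qed.
Lemma isotropy_mulVg : left_inverse isotropy_one isotropy_inv isotropy_mul.
Proof. by move=> g; apply/val_inj; rewrite /= gmulVl (isotropyP g).1. Qed.
Lemma isotropy_mulgV : right_inverse isotropy_one isotropy_inv isotropy_mul.
Proof. by move=> g; apply/val_inj; rewrite /= gmulVr (isotropyP g).2. Qed.

HB.instance Definition _ := isGroup.Build isotropy
  isotropy_mulA isotropy_mul1g isotropy_mulg1 isotropy_mulVg isotropy_mulgV.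

End Isotropy.

Section Operators.
Context (R : realType).
Local Notation C := R[i].

Record hilbertType := HilbertType {
  hilb_sort :> completeNormedModType C;
  hdot : {dot hilb_sort for Num.conj};
  hdot_norm : forall v, `|v| ^+ 2 = hdot v v
}.

(* Norms of normed modules over [C] take their values in [C]. *)
Definition rnorm (V : normedModType C) (v : V) : R := complex.Re `|v|.

Definition opnorm (E : Type) (D : set E) (N : E -> \bar R) (T : E -> E) :
    \bar R :=
  ereal_sup [set N (T v) | v in [set v | D v /\ (N v <= 1)%E]].

Definition l2norm (I : choiceType) (A : set I) (V : normedModType C)
    (xi : I -> V) : \bar R :=
  sqrte (\esum_(i in A) (rnorm (xi i) ^+ 2)%:E).

Definition hnorm (H : hilbertType) (v : H) : \bar R := (rnorm v)%:E.

Definition dirac_fun (T : choiceType) (g : T) : T -> C :=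
  fun k => (k == g)%:R.

(* [A] is a *-algebra of complex functions on [T], with pointwise linear
   structure, product [mul] and involution [star]; only the values of [pi] on
   [A] matter.  Representations are not required to be nondegenerate. *)
Record star_rep (T : Type) (A : set (T -> C))
    (mul : (T -> C) -> (T -> C) -> T -> C) (star : (T -> C) -> T -> C)
    (H : hilbertType) (pi : (T -> C) -> H -> H) : Prop := StarRep {
  rep_op_linear : forall f, A f -> linear (pi f);
  rep_op_bounded : forall f, A f -> continuous (pi f);
  rep_linear : forall (c : C) f1 f2 v, A f1 -> A f2 ->
    pi (fun t => c * f1 t + f2 t) v = c *: pi f1 v + pi f2 v;
  rep_mul : forall f1 f2 v, A f1 -> A f2 -> pi (mul f1 f2) v = pi f1 (pi f2 v);
  rep_star : forall f v w, A f -> hdot H (pi f v) w = hdot H v (pi (star f) w)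
}.

(* The complex group algebra of a discrete group. Its *-representations are
   the restrictions of the representations of the full group C*-algebra; the
   canonical unitaries are the functions [dirac_fun h]. *)
Section GroupAlgebra.
Context (L : groupType).

Definition group_alg : set (L -> C) := [set a | finite_set [set h | a h != 0]].
Definition group_conv (a b : L -> C) : L -> C :=
  fun g => \sum_(h \in [set: L]) a h * b (h^-1 * g)%g.
Definition group_star (a : L -> C) : L -> C := fun g => (a g^-1%g)^*.
Definition group_rep (H : hilbertType) (rho : (L -> C) -> H -> H) : Prop :=
  star_rep group_alg group_conv group_star rho.

(* Norm of the left regular representation on l^2(L). *)
Definition group_reduced_norm (a : L -> C) : \bar R :=
  opnorm [set xi | (l2norm [set: L] (xi : L -> C^o) < +oo)%E]
         (fun xi => l2norm [set: L] (xi : L -> C^o)) (group_conv a).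

End GroupAlgebra.

Section GroupoidAlgebra.
Context (G : etale_groupoid).

Definition Cc : set (arr G -> C) :=
  [set f | continuous (f : arr G -> C^o) /\
           compact (closure [set g | f g != 0])].
Definition conv (f1 f2 : arr G -> C) : arr G -> C :=
  fun g => \sum_(h \in [set h | tgt h = tgt g]) f1 h * f2 (gmul (ginv h) g).
Definition gstar (f : arr G -> C) : arr G -> C := fun g => (f (ginv g))^*.

Definition full_norm (f : arr G -> C) : \bar R :=
  ereal_sup [set r | exists (H : hilbertType) (pi : (arr G -> C) -> H -> H),
    star_rep Cc conv gstar pi /\ r = opnorm [set: H] (@hnorm H) (pi f)].

Definition src_fiber (x : obj G) : set (arr G) := [set g | src g = x].

(* l^2(G_y), its elements being extended by zero outside of G_y *)
Definition l2_fiber (y : obj G) : set (arr G -> C) :=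
  [set xi | (forall g, ~ src_fiber y g -> xi g = 0) /\
            (l2norm (src_fiber y) (xi : arr G -> C^o) < +oo)%E].

(* rho_y(f) delta_g *)
Definition regular_dirac (f : arr G -> C) (g : arr G) : arr G -> C :=
  fun k => \sum_(h \in src_fiber (tgt g)) f h * dirac_fun (gmul h g) k.

(* The bounded extension of rho_y(f) from the basis (delta_g) to l^2(G_y),
   evaluated at [k]: for [f] in [Cc] only finitely many [g] contribute. *)
Definition regular_op (y : obj G) (f xi : arr G -> C) : arr G -> C :=
  fun k => \sum_(g \in src_fiber y) xi g * regular_dirac f g k.

Definition reduced_norm (f : arr G -> C) : \bar R :=
  ereal_sup [set opnorm (l2_fiber y)
      (fun xi => l2norm (src_fiber y) (xi : arr G -> C^o)) (regular_op y f)
    | y in [set: obj G]].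

(* Elements of the full C*-algebra, the completion of [Cc] in [full_norm], are
   represented by Cauchy sequences in [Cc]. *)
Definition full_cauchy (f : nat -> arr G -> C) : Prop :=
  (forall n, Cc (f n)) /\
  forall e : R, 0 < e -> exists N : nat, forall m n : nat,
    (N <= m)%N -> (N <= n)%N ->
    (full_norm (fun g => (f m g - f n g)%R) <= e%:E)%E.

(* [N] is the operator norm [f |-> ||pi(f)||] of a representation [pi].  The
   element represented by [f] is mapped to 0 in the reduced C*-algebra iff
   [reduced_norm (f n)] tends to 0, and its image under (the extension of)
   [pi], being the limit of [pi (f n)], is 0 iff [N (f n)] tends to 0. *)
Definition factors_through_reduced (N : (arr G -> C) -> \bar R) : Prop :=
  forall f : nat -> arr G -> C, full_cauchy f ->
    reduced_norm (f n) @[n --> \oo] --> 0%E -> N (f n) @[n --> \oo] --> 0%E.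

Section Induction.
Context (x : obj G) (H : hilbertType) (rho : (isotropy x -> C) -> H -> H).

(* The norm of an equivariant [xi] is constant on left cosets of the isotropy
   group, so that it may be evaluated on any choice of representatives. *)
Definition left_coset (g : arr G) : set (arr G) :=
  [set gmul g (\val h) | h in [set: isotropy x]].
Definition left_cosets : set (set (arr G)) := left_coset @` src_fiber x.
Definition coset_repr (c : set (arr G)) : arr G := xget (idm x) c.

Definition ind_norm (xi : arr G -> H) : \bar R :=
  l2norm left_cosets (fun c => xi (coset_repr c)).

(* The space L; its elements are extended by zero outside of G_x. *)
Definition ind_space : set (arr G -> H) :=
  [set xi | [/\ forall g, ~ src_fiber x g -> xi g = 0,
                forall g (h : isotropy x), src_fiber x g ->
                  xi (gmul g (\val h)) = rho (group_star (dirac_fun h)) (xi g)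
              & (ind_norm xi < +oo)%E]].

Definition ind_op (f : arr G -> C) (xi : arr G -> H) : arr G -> H :=
  fun g => \sum_(h \in [set h | tgt h = tgt g]) f h *: xi (gmul (ginv h) g).

Definition ind_opnorm (f : arr G -> C) : \bar R :=
  opnorm ind_space ind_norm (ind_op f).

End Induction.

Definition e_norm (x : obj G) (a : isotropy x -> C) : \bar R :=
  ereal_sup [set r | exists (H : hilbertType) (rho : (isotropy x -> C) -> H -> H),
    [/\ group_rep rho, factors_through_reduced (ind_opnorm rho) &
        r = opnorm [set: H] (@hnorm H) (rho a)]].

End GroupoidAlgebra.
End Operators.

Record homeo_action (Gam : groupType) (X : topologicalType) := HomeoAction {
  act :> Gam -> X -> X;
  act1 : forall x, act 1%g x = x;
  actM : forall g h x, act (g * h)%g x = act g (act h x);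
  act_cont : forall g, continuous (act g)
}.

Section Transformation.
Context (Gam : groupType) (X : topologicalType) (a : homeo_action Gam X).

Lemma actK g : cancel (a g) (a g^-1%g).
Proof. by move=> x; rewrite -actM mulVg act1. Qed.

Definition tarr : topologicalType := (discrete_topology Gam * X)%type.
Definition tsrc (p : tarr) : X := p.2.
Definition ttgt (p : tarr) : X := a p.1 p.2.
Definition tidm (x : X) : tarr := (1%g, x).
Definition tmul (p q : tarr) : tarr := ((p.1 : Gam) * q.1, q.2)%g.
Definition tinv (p : tarr) : tarr := ((p.1 : Gam)^-1%g, a p.1 p.2).

Context (hX : hausdorff_space X) (lcX : locally_compact [set: X]).

Lemma tarr_nbhs (p : tarr) (A : set tarr) :
  nbhs p A <-> nbhs p.2 [set y | A (p.1, y)].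
Proof.
case: p => g x /=; split.
  move=> [[P Q] /= [Pg Qx] sub]; apply: filterS Qx => y Qy /=.
  by apply: sub; split => //=; exact: nbhs_singleton Pg.
move=> Ax; exists ([set g], [set y | A (g, y)]) => /=.
  by split => //; exact: (@discrete_set1 (discrete_topology Gam)).
by case=> h y /= [-> ?].
Qed.

Lemma tarr_continuous (Y : topologicalType) (f : tarr -> Y) :
  (forall g, continuous (fun x => f (g, x))) -> continuous f.
Proof.
move=> fc [g x] A /= fA; apply/tarr_nbhs => /=; exact: (fc g x A fA).
Qed.

Lemma tslice_continuous g : continuous (fun x : X => (g, x) : tarr).
Proof. by move=> x A /tarr_nbhs. Qed.

Lemma tsrc_cont : continuous tsrc.
Proof. by apply: tarr_continuous => g x; exact: cvg_id. Qed.

Lemma ttgt_cont : continuous ttgt.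
Proof. apply: tarr_continuous => g; have := @act_cont _ _ a g; exact. Qed.

Lemma tinv_cont : continuous tinv.
Proof.
apply: tarr_continuous => g x.
apply: (@continuous_comp _ _ _ (a g)
  (fun y : X => ((g : Gam)^-1%g, y) : tarr)); last exact: tslice_continuous.
by have := @act_cont _ _ a g; exact.
Qed.

Lemma tmul_cont : continuous (fun p : tarr * tarr => tmul p.1 p.2).
Proof.
move=> [[g x] [h y]] A /= /tarr_nbhs /= nA.
exists ([set p : tarr | p.1 = g],
        [set p : tarr | A ((g : Gam) * (h : Gam), p.2)%g /\ p.1 = h]) => /=.
  split; apply/tarr_nbhs => /=; first exact: nearW.
  by apply: filterS nA.
by case=> [[g' x'] [h' y']] /= [-> [? ->]].
Qed.

Lemma tarr_hausdorff : hausdorff_space tarr.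
Proof.
move=> [g x] [h y] cl.
have gh : g = h.
  have n1 : nbhs ((g, x) : tarr) [set p : tarr | p.1 = g].
    by apply/tarr_nbhs => /=; exact: nearW.
  have n2 : nbhs ((h, y) : tarr) [set p : tarr | p.1 = h].
    by apply/tarr_nbhs => /=; exact: nearW.
  by have [[g' z] /= [<- <-]] := cl _ _ n1 n2.
subst h; congr (_, _); apply: hX => A B nA nB.
have n1 : nbhs ((g, x) : tarr) [set p : tarr | A p.2] by apply/tarr_nbhs.
have n2 : nbhs ((g, y) : tarr) [set p : tarr | B p.2] by apply/tarr_nbhs.
by have [[g' z] /= [? ?]] := cl _ _ n1 n2; exists z.
Qed.

Lemma within_setT (T : Type) (F : set_system T) : within [set: T] F = F.
Proof.
apply/funext => A; rewrite /within; congr (F _).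
by apply/seteqP; split => y /=; [exact|].
Qed.

Lemma tarr_locally_compact : locally_compact [set: tarr].
Proof.
move=> [g x] _; have [U nU [cU _]] := @lcX x Logic.I.
exists ([set g] `*` U).
  have nU' : nbhs x U by rewrite within_setT in nU.
  have nV : nbhs ((g, x) : tarr) ([set g] `*` U).
    by apply/tarr_nbhs => /=; apply: filterS nU' => y Uy; split.
  by rewrite within_setT.
have cgU : compact ([set (g : discrete_topology Gam)] `*` U).
  by apply: compact_setX => //; exact: compact_set1.
by split => //; apply: compact_closed => //; exact: tarr_hausdorff.
Qed.

Lemma tsrc_etale (p : tarr) : exists U : set tarr,
  [/\ open U, U p, set_inj U tsrc &
      forall V, V `<=` U -> open V -> open (tsrc @` V)].
Proof.
exists [set q | q.1 = p.1]; split=> //.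
- rewrite openE => -[g x] /= gp; apply/tarr_nbhs => /=; exact: nearW.
- by move=> [g x] [h y] /set_mem /= -> /set_mem /= -> /= ->.
- move=> V VU; rewrite !openE => oV x [[g y] Vy /= <-].
  have /tarr_nbhs := oV _ Vy; apply: filterS => z /= Vz.
  by exists (g, z).
Qed.

Definition transformation_groupoid : etale_groupoid.
Proof.
refine (@EtaleGroupoid tarr X tsrc ttgt tidm tmul tinv _ _ _ _ _ _ _ _ _ _ _
  tsrc_cont ttgt_cont _ tinv_cont (continuous_subspaceT tmul_cont)
  tarr_hausdorff tarr_locally_compact tsrc_etale).
- by [].
- by move=> x; exact: act1.
- by [].
- by move=> [g x] [h y] /= ->; exact: actM.
- by move=> [g x] [h y] [k z] /= _ _; rewrite /tmul /= mulgA.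
- by move=> [g x]; rewrite /tmul /= mul1g.
- by move=> [g x]; rewrite /tmul /= mulg1.
- by [].
- by move=> [g x]; exact: actK.
- by move=> [g x]; rewrite /tmul /= mulVg.
- by move=> [g x]; rewrite /tmul /= mulgV.
- exact: tslice_continuous.
Defined.

End Transformation.

Section Stabilizer.
Context (Gam : groupType) (X : topologicalType) (a : homeo_action Gam X) (x : X).

Definition stabilizer_set : set Gam := [set g | a g x = x].
Definition stabilizer : Type := set_type stabilizer_set.

HB.instance Definition _ := Choice.on stabilizer.

Lemma stabilizerP (g : stabilizer) : a (\val g) x = x.
Proof. by case: g => g /= /set_mem. Qed.

Definition stabilizer_of g (gx : a g x = x) : stabilizer :=
  @SigSub _ _ _ g (mem_set (gx : stabilizer_set g)).

Lemma stab_mul_subproof (g h : stabilizer) : a (\val g * \val h)%g x = x.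
Proof. by rewrite actM !stabilizerP. Qed.
Lemma stab_inv_subproof (g : stabilizer) : a (\val g)^-1%g x = x.
Proof. by rewrite -{1}(stabilizerP g) actK. Qed.

Definition stab_one : stabilizer := stabilizer_of (act1 a x).
Definition stab_mul (g h : stabilizer) := stabilizer_of (stab_mul_subproof g h).
Definition stab_inv (g : stabilizer) := stabilizer_of (stab_inv_subproof g).

Lemma stab_mulA : associative stab_mul.
Proof. by move=> g h k; apply/val_inj; exact: mulgA. Qed.
Lemma stab_mul1g : left_id stab_one stab_mul.
Proof. by move=> g; apply/val_inj; exact: mul1g. Qed.
Lemma stab_mulg1 : right_id stab_one stab_mul.
Proof. by move=> g; apply/val_inj; exact: mulg1. Qed.
Lemma stab_mulVg : left_inverse stab_one stab_inv stab_mul.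
Proof. by move=> g; apply/val_inj; exact: mulVg. Qed.
Lemma stab_mulgV : right_inverse stab_one stab_inv stab_mul.
Proof. by move=> g; apply/val_inj; exact: mulgV. Qed.

HB.instance Definition _ := isGroup.Build stabilizer
  stab_mulA stab_mul1g stab_mulg1 stab_mulVg stab_mulgV.

Context (hX : hausdorff_space X) (lcX : locally_compact [set: X]).
Local Notation G := (transformation_groupoid a hX lcX).

Definition stab_isotropy (g : stabilizer) : @isotropy G x :=
  @isotropy_of G x (\val g, x) (erefl x) (stabilizerP g).

Lemma stab_isotropyM (g h : stabilizer) :
  stab_isotropy (g * h)%g = (stab_isotropy g * stab_isotropy h)%g.
Proof. exact/val_inj. Qed.

Lemma stab_isotropy_bij : bijective stab_isotropy.
Proof.
have isoP (p : @isotropy G x) : a (\val p).1 x = x.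
  have [ps pt] := isotropyP p.
  by move: (\val p) ps pt => [g y] /= ps pt; rewrite -[in LHS]ps.
exists (fun p => stabilizer_of (isoP p)) => [g|p]; apply/val_inj => //=.
have [ps _] := isotropyP p.
by rewrite [RHS]surjective_pairing; congr (_, _); exact: esym ps.
Qed.

End Stabilizer.

(* Main.v *)
Require Import Defs.
From HB Require Import structures.
From mathcomp Require Import all_boot all_order all_algebra complex.
From mathcomp Require Import all_classical all_reals all_analysis.
From mathcomp Require Import finmap ring lra.

(** Write [L] for the isotropy group at [x], and let [a] be an element of its
group algebra.

The e-norm dominates the reduced norm because the regular representation of [L]
is one of the representations over which the supremum is taken: evaluating an
equivariant function with values in l^2(L) at the unit of [L] identifies the
representation induced by the regular one with the representation rho_x on
l^2(G_x) ([ind_opnorm_left_reg_le]), whose norm is at most the reduced norm.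

Conversely, let Ind rho factor through the reduced C*-algebra, and suppose that
||rho(a)v|| > r > ||a||_r for some unit vector [v]. Spectral theory suggests the
contradiction: the positive part of a*a - r^2 vanishes in the reduced
C*-algebra of [L], but rho does not kill it. It has to be transported to the
groupoid. For a function [b] on [L] and a compactly supported function [u] on
[X], let b (x) u be the function (g,y) |-> b(g)u(y) on the groupoid. Since elements
of [L] act on all of [X], and not only near [x], this assignment has three
properties, if [u] is a suitable function with values in [-1,1] and u(x) = 1:

- ||b (x) u||_r is at most ||b||_r, because each fibre of the groupoid is a union
  of free [L]-orbits and b acts on each of them as in the regular
  representation of [L], after multiplication by [u] ([reduced_norm_tensor]);
- ||Ind rho(b (x) u)|| is at least ||rho(b)v|| for a unit vector [v]
  ([ind_opnorm_tensor_ge]);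
- for every representation pi of the groupoid algebra, b |-> pi(b (x) u)v
  behaves like the orbit map of a vector in a representation of the group
  algebra, in the sense of [covariant] ([tensor_covariant]), and pi(1 (x) u) is a contraction
  ([tensor_contraction]).

The positive part of a*a - r^2 is only a limit of elements b_n of the group
algebra: b_n is a Bernstein polynomial of t |-> max(t - c, 0) evaluated at a*a/M,
where M = N^2 + r^2, [N] bounds [a] in all representations, and c = r^2/M. By the
third property b_n (x) u is a Cauchy sequence in the full norm
([truncation_full_cauchy]), by the first it tends to 0 in the reduced norm
([truncation_reduced_cvg0]), and by the second its image under Ind rho stays away
from 0, as max(t - c, 0) >= t - c ([rep_le_of_factors]). This contradicts the
factorization.

The estimates on b_n must hold in all representations at once. They come from
algebraic certificates instead of a functional calculus: an inequality between
polynomials of a*a/M is derived in a cone which contains 1, X and 1 - X and is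
stable under sums and under multiplication by squares, and the
polynomials in such a cone act as positive operators under every covariant map ([sqop_cone], [oper_coneP]). Bernstein operators
are convenient because they turn pointwise inequalities at the nodes into such
certificates ([bernstein_bcone]). *)

Set Implicit Arguments.
Unset Strict Implicit.
Unset Printing Implicit Defensive.

Import Order.TTheory GRing.Theory Num.Theory.
Import numFieldNormedType.Exports.

Local Open Scope classical_set_scope.
Local Open Scope ring_scope.

(** * Real-valued norms *)

Section Rnorm.
Context (R : realType).
Local Notation C := R[i].

Lemma rnormE (V : normedModType C) (v : V) : `|v| = (rnorm v)%:C%C.
Proof. by rewrite /rnorm RRe_real // ger0_real. Qed.

Lemma rnorm_ge0 (V : normedModType C) (v : V) : 0 <= rnorm v.
Proof. by rewrite -lecR -rnormE normr_ge0. Qed.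

Lemma rnorm0 (V : normedModType C) : rnorm (0 : V) = 0.
Proof. by rewrite /rnorm normr0. Qed.

Lemma rnormD (V : normedModType C) (v w : V) : rnorm (v + w) <= rnorm v + rnorm w.
Proof. by rewrite -lecR rmorphD /= -!rnormE ler_normD. Qed.

Lemma rnormZ (V : normedModType C) (c : C) (v : V) :
  rnorm (c *: v) = rnorm (c : C^o) * rnorm v.
Proof. by apply: complexI; rewrite rmorphM /= -!rnormE normrZ. Qed.

Lemma rnormN (V : normedModType C) (v : V) : rnorm (- v) = rnorm v.
Proof. by rewrite /rnorm normrN. Qed.

Lemma rnorm_eq0 (V : normedModType C) (v : V) : rnorm v = 0 -> v = 0.
Proof. by move=> v0; apply/normr0_eq0; rewrite rnormE v0. Qed.

Lemma rnormR (c : R) : 0 <= c -> rnorm (c%:C%C : C^o) = c.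
Proof. by move=> c0; apply: complexI; rewrite -rnormE ger0_norm ?lecR. Qed.

Lemma rnorm_sqr (z : C) :
  rnorm (z : C^o) ^+ 2 = complex.Re z ^+ 2 + complex.Im z ^+ 2.
Proof.
by case: z => x y; rewrite /rnorm normc_def /= sqr_sqrtr // addr_ge0 ?sqr_ge0.
Qed.

Lemma rnormM (z w : C) : rnorm (z * w : C^o) = rnorm (z : C^o) * rnorm (w : C^o).
Proof. by apply: complexI; rewrite rmorphM /= -!rnormE normrM. Qed.

Lemma rnorm_conj (z : C) : rnorm (z^* : C^o) = rnorm (z : C^o).
Proof. by rewrite /rnorm norm_conjC. Qed.

End Rnorm.

(** * Absolutely summable real families *)

Section RealSum.
Context (R : realType) (I : choiceType).
Implicit Types u v p q : I -> R.

Definition psum p : R := fine (\esum_(i in [set: I]) (p i)%:E).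
Definition psummable p : Prop :=
  (forall i, 0 <= p i) /\ (\esum_(i in [set: I]) (p i)%:E < +oo)%E.

Lemma esum_psum p : psummable p ->
  (\esum_(i in [set: I]) (p i)%:E)%E = (psum p)%:E.
Proof.
move=> [p0 ps]; rewrite /psum fineK // ge0_fin_numE //.
by apply: esum_ge0 => i _; rewrite lee_fin.
Qed.

Lemma psummable_le p q : (forall i, 0 <= p i <= q i) -> psummable q -> psummable p.
Proof.
move=> pq [q0 qs]; split=> [i|]; first by have /andP[] := pq i.
apply: le_lt_trans qs; apply: le_esum => i _; rewrite lee_fin.
by have /andP[] := pq i.
Qed.

Lemma psumD_esum p q : psummable p -> psummable q ->
  (\esum_(i in [set: I]) (p i + q i)%:E)%E = (psum p + psum q)%:E.
Proof.
move=> ps qs; under eq_esum do rewrite EFinD.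
rewrite esumD; last 2 first.
- by move=> i _; rewrite lee_fin; apply: ps.1.
- by move=> i _; rewrite lee_fin; apply: qs.1.
by rewrite !esum_psum.
Qed.

Lemma psummableD p q : psummable p -> psummable q ->
  psummable (fun i => p i + q i).
Proof.
move=> ps qs; split; first by move=> i; apply: addr_ge0; [apply: ps.1|apply: qs.1].
by rewrite psumD_esum // ltry.
Qed.

Lemma psumD p q : psummable p -> psummable q ->
  psum (fun i => p i + q i) = psum p + psum q.
Proof. by move=> ps qs; rewrite /psum psumD_esum. Qed.

Lemma esumZ (A : set I) (c : R) (f : I -> \bar R) : 0 <= c ->
  (forall i, 0 <= f i)%E ->
  (\esum_(i in A) (c%:E * f i) = c%:E * \esum_(i in A) f i)%E.
Proof.
move=> c0 f0; rewrite /esum -ereal_supZl //; last first.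
  apply/set0P; exists (\sum_(i \in set0) f i)%E; exists set0 => //.
  exact: fsets_set0.
congr ereal_sup; apply/seteqP; split=> [_ [F [finF FA] <-]|_ [_ [F [finF FA] <-] <-]].
  exists (\sum_(i \in F) f i)%E; first by exists F.
  by rewrite !fsbig_finite //= ge0_sume_distrr.
by exists F => //; rewrite !fsbig_finite //= ge0_sume_distrr.
Qed.

Lemma psumZ_esum c p : 0 <= c -> psummable p ->
  (\esum_(i in [set: I]) (c * p i)%:E)%E = (c * psum p)%:E.
Proof.
move=> c0 ps; under eq_esum do rewrite EFinM.
by rewrite esumZ ?esum_psum // => i; rewrite lee_fin; apply: ps.1.
Qed.

Lemma psummableZ c p : 0 <= c -> psummable p -> psummable (fun i => c * p i).
Proof.
move=> c0 ps; split; first by move=> i; apply: mulr_ge0 => //; apply: ps.1.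
by rewrite psumZ_esum // ltry.
Qed.

Lemma psumZ c p : 0 <= c -> psummable p -> psum (fun i => c * p i) = c * psum p.
Proof. by move=> c0 ps; rewrite /psum psumZ_esum. Qed.

Lemma le_psum p q : psummable p -> psummable q ->
  (forall i, p i <= q i) -> psum p <= psum q.
Proof.
move=> ps qs pq; rewrite -lee_fin -!esum_psum //.
by apply: le_esum => i _; rewrite lee_fin.
Qed.

Lemma psum_ge0 p : psummable p -> 0 <= psum p.
Proof.
move=> ps; rewrite -lee_fin -esum_psum //.
by apply: esum_ge0 => i _; rewrite lee_fin; apply: ps.1.
Qed.

Lemma psum_ge_fsum p (F : set I) : psummable p -> finite_set F ->
  \sum_(i \in F) p i <= psum p.
Proof.
move=> ps finF; rewrite -lee_fin -esum_psum // -fsumEFin //.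
by apply: ereal_sup_ubound; exists F.
Qed.

Lemma psum_ge1 p i : psummable p -> p i <= psum p.
Proof.
by move=> ps; apply: le_trans (psum_ge_fsum ps (finite_set1 i)); rewrite fsbig_set1.
Qed.

Lemma psum_sup p c : (forall i, 0 <= p i) ->
  (forall F : set I, finite_set F -> \sum_(i \in F) p i <= c) ->
  psummable p /\ psum p <= c.
Proof.
move=> p0 Fc.
have le : (\esum_(i in [set: I]) (p i)%:E <= c%:E)%E.
  apply: ge_ereal_sup => _ [F [finF _] <-].
  by rewrite fsumEFin // lee_fin Fc.
have ps : psummable p by split=> //; apply: le_lt_trans le (ltry _).
by split=> //; rewrite -lee_fin -esum_psum.
Qed.

Definition summ u := psummable (fun i => `|u i|).

(** The sum of u^+ minus that of u^-, with u^- added to both families: absolute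
values and differences are easier to handle than positive and negative parts. *)
Definition rsum u := psum (fun i => `|u i|) - psum (fun i => `|u i| - u i).

Lemma summ_neg u : summ u -> psummable (fun i => `|u i| - u i).
Proof.
move=> us; apply: psummable_le (psummableD us us) => i.
by rewrite subr_ge0 ler_norm lerD2l ler_normr lexx orbT.
Qed.

Lemma summ_le u p : (forall i, `|u i| <= p i) -> psummable p -> summ u.
Proof. by move=> up; apply: psummable_le => i; rewrite normr_ge0 up. Qed.

Lemma summB p q : psummable p -> psummable q -> summ (fun i => p i - q i).
Proof.
move=> ps qs; apply: summ_le (psummableD ps qs) => i.
by apply: le_trans (ler_normB _ _) _; rewrite !ger0_norm //; [apply: qs.1|apply: ps.1].
Qed.

(** The value does not depend on the way of writing a family as a difference of
nonnegative ones; linearity of the sum follows from this alone. *)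
Lemma rsumB p q : psummable p -> psummable q ->
  rsum (fun i => p i - q i) = psum p - psum q.
Proof.
move=> ps qs; have us := summB ps qs; have ns := summ_neg us.
apply/eqP; rewrite /rsum subr_eq addrAC eq_sym subr_eq -!psumD //.
by apply/eqP; congr (psum _); apply/funext => i; ring.
Qed.

Lemma rsum_psum p : psummable p -> rsum p = psum p.
Proof.
move=> ps; have pE i : `|p i| = p i by rewrite ger0_norm //; apply: ps.1.
rewrite /rsum (_ : (fun i => `|p i|) = p); last exact/funext.
rewrite (_ : (fun i => _ - _) = fun=> 0); last by apply/funext => i; rewrite pE subrr.
by rewrite {2}/psum esum1 ?subr0.
Qed.

Lemma summD u v : summ u -> summ v -> summ (fun i => u i + v i).
Proof.
by move=> us vs; apply: summ_le (psummableD us vs) => i; exact: ler_normD.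
Qed.

Lemma rsumD u v : summ u -> summ v ->
  rsum (fun i => u i + v i) = rsum u + rsum v.
Proof.
move=> us vs; have uns := summ_neg us; have vns := summ_neg vs.
rewrite {2 3}/rsum addrACA -opprD -!psumD // -rsumB; last 2 first.
- exact: psummableD.
- exact: psummableD.
by congr rsum; apply/funext => i; ring.
Qed.

Lemma summZ c u : summ u -> summ (fun i => c * u i).
Proof.
move=> us; apply: summ_le (psummableZ (normr_ge0 c) us) => i.
by rewrite normrM.
Qed.

Lemma rsumZ c u : summ u -> rsum (fun i => c * u i) = c * rsum u.
Proof.
move=> us; have uns := summ_neg us.
have [c0|/ltW c0] := leP 0 c.
  rewrite {2}/rsum mulrBr -!psumZ // -rsumB; try exact: psummableZ.
  by congr rsum; apply/funext => i; ring.
have nc0 : 0 <= - c by rewrite oppr_ge0.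
rewrite {2}/rsum -[c in RHS]opprK mulNr mulrBr opprB -!psumZ // -rsumB; try exact: psummableZ.
by congr rsum; apply/funext => i; ring.
Qed.

End RealSum.

Lemma psum_reindex (R : realType) (I J : choiceType) (e : I -> J) (p : J -> R) :
  bijective e -> psum (fun i => p (e i)) = psum p.
Proof.
move=> be; rewrite /psum; congr fine; symmetry; apply: reindex_esum.
by rewrite setTT_bijective.
Qed.

Lemma psummable_reindex (R : realType) (I J : choiceType) (e : I -> J) (p : J -> R) :
  bijective e -> psummable p -> psummable (fun i => p (e i)).
Proof.
move=> be [p0 ps]; split=> //; rewrite -(reindex_esum setT setT e (fun j => (p j)%:E)) //.
by rewrite setTT_bijective.
Qed.

Lemma rsum_reindex (R : realType) (I J : choiceType) (e : I -> J) (u : J -> R) :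
  bijective e -> rsum (fun i => u (e i)) = rsum u.
Proof.
move=> be; rewrite /rsum (psum_reindex (fun j => `|u j|) be).
by rewrite (psum_reindex (fun j => `|u j| - u j) be).
Qed.

(** * The Banach space of square-summable functions *)

Section L2.
Context (R : realType) (L : choiceType).
Local Notation C := R[i].
Implicit Types xi eta : L -> C^o.

Definition l2mass xi : L -> R := fun i => rnorm (xi i) ^+ 2.

Definition l2pred : pred (L -> C^o) := fun xi => (l2norm [set: L] xi < +oo)%E.

Lemma l2predP xi : reflect (psummable (l2mass xi)) (xi \in l2pred).
Proof.
rewrite -[_ \in _]/(l2norm [set: L] xi < +oo)%E /l2norm -[X in (_ < X)%E]/(sqrte +oo).
have e0 : (0 <= \esum_(i in [set: L]) (rnorm (xi i) ^+ 2)%:E)%E.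
  by apply: esum_ge0 => i _; rewrite lee_fin sqr_ge0.
rewrite ltNge lee_sqrt // -ltNge.
by apply: (iffP idP) => [h|[]//]; split=> // i; exact: sqr_ge0.
Qed.

Lemma rnorm_sqrD (V : normedModType C) (v w : V) :
  rnorm (v + w) ^+ 2 <= 2 * rnorm v ^+ 2 + 2 * rnorm w ^+ 2.
Proof.
apply: (@le_trans _ _ ((rnorm v + rnorm w) ^+ 2)).
  by rewrite ler_pXn2r ?nnegrE ?rnorm_ge0 ?addr_ge0 ?rnorm_ge0 // rnormD.
by have := sqr_ge0 (rnorm v - rnorm w); nra.
Qed.

Lemma l2mass_submod : GRing.submod_closed l2pred.
Proof.
split=> [|c xi eta /l2predP xs /l2predP es]; apply/l2predP.
  split=> [i|]; first exact: sqr_ge0.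
  by rewrite esum1 // => i _; rewrite /l2mass rnorm0 expr0n.
have c0 : 0 <= rnorm (c : C^o) ^+ 2 by exact: sqr_ge0.
apply: psummable_le (psummableD (psummableZ (ler0n _ 2) (psummableZ c0 xs)) (psummableZ (ler0n _ 2) es)) => i.
rewrite sqr_ge0 /= (le_trans (rnorm_sqrD _ _)) // lerD2r ler_pM2l ?ltr0n //.
by rewrite /l2mass -exprMn rnormZ.
Qed.

HB.instance Definition _ := GRing.isSubmodClosed.Build C (L -> C^o) l2pred l2mass_submod.

Record l2 := L2 { l2fun :> L -> C^o; l2fun_subproof : l2fun \in l2pred }.
HB.instance Definition _ := [isSub of l2 for l2fun].
HB.instance Definition _ := [Choice of l2 by <:].
HB.instance Definition _ := [SubChoice_isSubLmodule of l2 by <:].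

Lemma l2P (v : l2) : psummable (l2mass v).
Proof. by apply/l2predP/l2fun_subproof. Qed.

Lemma l2_eqP (v w : l2) : (forall i, v i = w i) -> v = w.
Proof. by move=> vw; apply: val_inj; apply/funext. Qed.

Lemma l2D (v w : l2) i : (v + w) i = v i + w i. Proof. by []. Qed.
Lemma l2Z (c : C) (v : l2) i : (c *: v) i = c * v i. Proof. by []. Qed.
Lemma l2N (v : l2) i : (- v) i = - v i. Proof. by []. Qed.

Definition l2n (v : l2) : R := Num.sqrt (psum (l2mass v)).

Lemma l2n_ge0 v : 0 <= l2n v. Proof. exact: sqrtr_ge0. Qed.
Lemma l2n_sqr v : l2n v ^+ 2 = psum (l2mass v).
Proof. by rewrite sqr_sqrtr // psum_ge0 //; exact: l2P. Qed.

Lemma l2n_ge (v : l2) i : rnorm (v i) <= l2n v.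
Proof.
rewrite -(@ler_pXn2r _ 2) ?nnegrE ?rnorm_ge0 ?l2n_ge0 // l2n_sqr.
exact: (psum_ge1 i (l2P v)).
Qed.

Lemma l2n_eq0 v : l2n v = 0 -> v = 0.
Proof.
move=> v0; apply: l2_eqP => i; apply: rnorm_eq0.
by apply/eqP; rewrite eq_le rnorm_ge0 andbT -v0 l2n_ge.
Qed.

Lemma l2nZ (c : C) v : l2n (c *: v) = rnorm (c : C^o) * l2n v.
Proof.
have c0 : 0 <= rnorm (c : C^o) ^+ 2 by exact: sqr_ge0.
rewrite /l2n (_ : l2mass _ = fun i => rnorm (c : C^o) ^+ 2 * l2mass v i).
  rewrite psumZ //; last exact: l2P.
  by rewrite sqrtrM // sqrtr_sqr ger0_norm ?rnorm_ge0.
by apply/funext => i; rewrite /l2mass -exprMn -rnormZ.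
Qed.

(** The weighted inequality (x+y)^2 <= (1+b/a)x^2 + (1+a/b)y^2 holds termwise, and
with a, b the two norms its sum is (a+b)^2. *)
Lemma l2nD v w : l2n (v + w) <= l2n v + l2n w.
Proof.
have [/eqP/l2n_eq0->|v0] := boolP (l2n v == 0); first by rewrite add0r lerDr l2n_ge0.
have [/eqP/l2n_eq0->|w0] := boolP (l2n w == 0); first by rewrite addr0 lerDl l2n_ge0.
have vp : 0 < l2n v by rewrite lt0r v0 l2n_ge0.
have wp : 0 < l2n w by rewrite lt0r w0 l2n_ge0.
rewrite -(@ler_pXn2r _ 2) ?nnegrE ?l2n_ge0 ?addr_ge0 ?l2n_ge0 //.
set a := l2n v in v0 vp *; set b := l2n w in w0 wp *.
have ba : 0 <= 1 + b / a by rewrite addr_ge0 // divr_ge0 ?ltW.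
have ab : 0 <= 1 + a / b by rewrite addr_ge0 // divr_ge0 ?ltW.
have -> : (a + b) ^+ 2 = (1 + b / a) * psum (l2mass v) + (1 + a / b) * psum (l2mass w).
  by rewrite -!l2n_sqr -/a -/b; field; rewrite v0 w0.
rewrite l2n_sqr -!psumZ //; try exact: l2P.
rewrite -psumD; try (apply: psummableZ => //; exact: l2P).
apply: le_psum => [||i]; first exact: l2P.
  by apply: psummableD; apply: psummableZ => //; exact: l2P.
rewrite /l2mass; set x := rnorm (v i); set y := rnorm (w i).
apply: (@le_trans _ _ ((x + y) ^+ 2)).
  by rewrite ler_pXn2r ?nnegrE ?addr_ge0 ?rnorm_ge0 // rnormD.
rewrite -subr_ge0 (_ : _ - _ = (b * x - a * y) ^+ 2 / (a * b)).
  by rewrite divr_ge0 ?sqr_ge0 // mulr_ge0 ?ltW.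
by field; rewrite v0 w0.
Qed.

Definition l2normC (v : l2) : C := (l2n v)%:C%C.

Fact l2_normD v w : l2normC (v + w) <= l2normC v + l2normC w.
Proof. by rewrite /l2normC -rmorphD /= lecR l2nD. Qed.
Fact l2_normZ c v : l2normC (c *: v) = `|c| * l2normC v.
Proof. by rewrite /l2normC l2nZ rmorphM /= (rnormE (c : C^o)). Qed.
Fact l2_norm_eq0 v : l2normC v = 0 -> v = 0.
Proof. by case=> /l2n_eq0. Qed.

HB.instance Definition _ := Lmodule_isNormed.Build C l2 l2_normD l2_normZ l2_norm_eq0.

Lemma l2_rnormE (v : l2) : rnorm v = l2n v.
Proof. by []. Qed.

(** Real and imaginary parts of the values converge, which gives a pointwise limit
[xi] of a Cauchy filter. It is a limit in norm because a finite partial sum of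
|w - xi|^2 may be estimated through a [w'] that is chosen deep in the filter
after the finite set: [w'] is as close to [xi] as needed on that set, and its
distance to [w] is bounded independently of the set. *)
Lemma l2_complete (F : set_system l2) : ProperFilter F -> cauchy F -> cvg F.
Proof.
move=> FF /cauchyP Fc.
have Fc' (e : R) : 0 < e -> exists v0 : l2, \forall w \near F, l2n (v0 - w) < e.
  move=> e0; have [|v0 hv0] := Fc e%:C%C; first by rewrite ltcR.
  exists v0; apply: filterS hv0 => w; rewrite -ball_normE /= => h.
  by rewrite -l2_rnormE -ltcR -rnormE.
have part (p : C -> R) : (forall z, `|p z| <= rnorm (z : C^o)) ->
    (forall z w, p (z - w) = p z - p w) ->
    forall i, exists c : R, forall e : R, 0 < e -> \forall w \near F, `|c - p ((w : l2) i)| < e.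
  move=> ple pB i; have FFi : ProperFilter ((fun w : l2 => p (w i)) @ F) by exact: fmap_proper_filter.
  have : cvg ((fun w : l2 => p (w i)) @ F).
    apply: R_complete; apply/cauchyP => e e0.
    have [v0 hv0] := Fc' e e0; exists (p (v0 i)); apply: filterS hv0 => w /= h.
    rewrite -ball_normE /= -pB; apply: le_lt_trans (ple _) _.
    by apply: le_lt_trans h; rewrite -[v0 i - w i]/((v0 - w) i) l2n_ge.
  move=> /cvg_ex[c /= hc]; exists c => e e0.
  by have /cvgrPdist_lt/(_ e e0) := hc.
have le_re (z : C) : `|complex.Re z| <= rnorm (z : C^o).
  rewrite -ler_sqr ?nnegrE ?rnorm_ge0 // rnorm_sqr real_normK ?num_real //.
  by rewrite lerDl sqr_ge0.
have sub_re (z w : C) : complex.Re (z - w) = complex.Re z - complex.Re w by case: z w => [? ?] [? ?].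
have [re hre] := choice (part _ le_re sub_re).
have le_im (z : C) : `|complex.Im z| <= rnorm (z : C^o).
  rewrite -ler_sqr ?nnegrE ?rnorm_ge0 // rnorm_sqr real_normK ?num_real //.
  by rewrite lerDr sqr_ge0.
have sub_im (z w : C) : complex.Im (z - w) = complex.Im z - complex.Im w by case: z w => [? ?] [? ?].
have [im him] := choice (part _ le_im sub_im).
pose xi : L -> C^o := fun i => (re i +i* im i)%C.
have hxi i (e : R) : 0 < e -> \forall w \near F, rnorm ((w : l2) i - xi i) ^+ 2 < e.
  move=> e0; pose d := Num.sqrt (e / 2).
  have d2 : d ^+ 2 = e / 2 by rewrite sqr_sqrtr // divr_ge0 // ltW.
  have d0 : 0 < d by rewrite sqrtr_gt0 divr_gt0.
  apply: filterS2 (hre i d d0) (him i d d0) => w h1 h2.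
  rewrite rnorm_sqr.
  have -> : e = d ^+ 2 + d ^+ 2 by rewrite d2; lra.
  case: (w i) h1 h2 => x y /= h1 h2.
  rewrite distrC in h1; rewrite distrC in h2.
  by apply: ltrD; rewrite -real_normK ?num_real // ltr_pXn2r // nnegrE ltW.
(* 10 = 2 * 2^2 + 2: the part through [w'] costs 2(2e)^2, as [w] and [w'] are both
   [e]-close to [v0], and the part on the finite set costs 2e^2. *)
have close_to_xi (e : R) : 0 < e -> \forall w \near F,
    psummable (fun i => rnorm ((w : l2) i - xi i) ^+ 2) /\
    psum (fun i => rnorm (w i - xi i) ^+ 2) <= 10 * e ^+ 2.
  move=> e0; have [v0 hv0] := Fc' e e0; near=> w.
  have hw : l2n (v0 - w) < e by near: w.
  apply: psum_sup => [i|S finS]; first exact: sqr_ge0.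
  pose k : R := (size (enum_fset (fset_set S)))%:R.
  have k1 : 0 < k + 1 by rewrite ltr_wpDl.
  have hS : \forall w' \near F, forall i, S i -> rnorm ((w' : l2) i - xi i) ^+ 2 < e ^+ 2 / (k + 1).
    have h (i : L) : i \in fset_set S -> F [set w' : l2 | rnorm (w' i - xi i) ^+ 2 < e ^+ 2 / (k + 1)].
      by move=> _; apply: hxi; rewrite divr_gt0 // exprn_gt0.
    apply: filterS (filter_bigI _ h) => w' /= hw' i Si.
    by apply: (hw' i) => /=; rewrite in_fset_set //; exact/mem_set.
  have [w' [hw' hw'S]] : exists w' : l2, l2n (v0 - w') < e /\ forall i, S i -> rnorm (w' i - xi i) ^+ 2 < e ^+ 2 / (k + 1).
    by apply: (@filter_ex _ F); near=> w'; split; near: w'.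
  apply: (@le_trans _ _ (\sum_(i \in S) (2 * l2mass (w - w') i + 2 * (e ^+ 2 / (k + 1))))).
    rewrite !fsbig_finite //= [in leLHS]big_seq [in leRHS]big_seq; apply: ler_sum => i.
    rewrite in_fset_set // => /set_mem Si.
    have -> : w i - xi i = (w - w') i + (w' i - xi i) by rewrite l2D l2N addrA subrK.
    apply: (le_trans (rnorm_sqrD _ _)); rewrite lerD2l ler_pM2l //.
    exact/ltW/hw'S.
  have ww' : psum (l2mass (w - w')) <= (2 * e) ^+ 2.
    have e2 : 0 <= 2 * e by rewrite mulr_ge0 // ltW.
    rewrite -l2n_sqr ler_pXn2r ?nnegrE ?l2n_ge0 //.
    have -> : w - w' = (v0 - w') - (v0 - w) by rewrite opprB [RHS]addrC subrKA.
    apply: (le_trans (l2nD _ _)); rewrite -[l2n (- _)]l2_rnormE rnormN l2_rnormE.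
    by rewrite mulr2n mulrDl mul1r lerD // ltW.
  rewrite fsbig_split //= -mulr_fsumr //.
  apply: (@le_trans _ _ (2 * (2 * e) ^+ 2 + 2 * e ^+ 2)).
    apply: lerD.
      rewrite ler_pM2l // (le_trans _ ww') //; exact: (psum_ge_fsum (l2P (w - w')) finS).
    rewrite fsbig_finite //= big_const_seq count_predT iter_addr_0.
    rewrite -[_ *+ _]mulr_natr -/k -subr_ge0.
    rewrite (_ : _ - _ = 2 * e ^+ 2 / (k + 1)); last by field; rewrite gt_eqF.
    by rewrite divr_ge0 ?mulr_ge0 ?sqr_ge0 // ltW.
  by rewrite exprMn; lra.
have [w0 [w0s _]] : exists w : l2, psummable (fun i => rnorm ((w : l2) i - xi i) ^+ 2) /\
    psum (fun i => rnorm (w i - xi i) ^+ 2) <= 10 * 1 ^+ 2.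
  exact: (filter_ex (close_to_xi 1 ltr01)).
have xiP : xi \in l2pred.
  rewrite -[xi](subKr (w0 : L -> C^o)) rpredB //; first exact: l2fun_subproof.
  exact/l2predP.
apply/cvg_ex; exists (L2 xiP); apply/cvgrPdist_lt => e' e'0.
have [e e0 ->] : exists2 e : R, 0 < e & e' = e%:C%C.
  exists (complex.Re e'); last by rewrite RRe_real // gtr0_real.
  by rewrite -ltcR RRe_real // gtr0_real.
(* 10 (e/4)^2 < e^2 *)
have e4 : 0 < e / 4 by rewrite divr_gt0.
apply: filterS (close_to_xi _ e4) => w [ws wle].
rewrite distrC rnormE ltcR l2_rnormE -(@ltr_pXn2r _ 2) ?nnegrE ?l2n_ge0 ?ltW //.
rewrite l2n_sqr; apply: le_lt_trans wle _.
have e2 : 0 < e ^+ 2 by rewrite exprn_gt0.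
by rewrite expr_div_n; lra.
Unshelve. all: by end_near. Qed.

HB.instance Definition _ := Uniform_isComplete.Build l2 l2_complete.

End L2.

(** * The Hilbert space of square-summable functions *)

Section L2Dot.
Context (R : realType) (L : choiceType).
Local Notation C := R[i].
Local Notation l2 := (l2 R L).
Implicit Types (v w : l2) (z : L -> C).

Definition csumm z := summ (fun i => complex.Re (z i)) /\ summ (fun i => complex.Im (z i)).
Definition csum z : C := (rsum (fun i => complex.Re (z i)) +i* rsum (fun i => complex.Im (z i)))%C.

Lemma csummP z p : psummable p -> (forall i, rnorm (z i : C^o) <= p i) -> csumm z.
Proof.
move=> ps zp; split; apply: (summ_le _ ps) => i; apply: le_trans (zp i);
  rewrite -ler_sqr ?nnegrE ?rnorm_ge0 // rnorm_sqr real_normK ?num_real //.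
- by rewrite lerDl sqr_ge0.
- by rewrite lerDr sqr_ge0.
Qed.

Lemma csumP (c : C) z1 z2 : csumm z1 -> csumm z2 ->
  csum (fun i => c * z1 i + z2 i) = c * csum z1 + csum z2.
Proof.
move=> [s1 t1] [s2 t2]; case: c => x y; rewrite /csum /=; apply/eqP.
have -> : (fun i => complex.Re ((x +i* y)%C * z1 i + z2 i)) =
    fun i => (x * complex.Re (z1 i) + (- y) * complex.Im (z1 i)) + complex.Re (z2 i).
  by apply/funext => i; case: (z1 i) (z2 i) => [? ?] [? ?] /=; ring.
have -> : (fun i => complex.Im ((x +i* y)%C * z1 i + z2 i)) =
    fun i => (x * complex.Im (z1 i) + y * complex.Re (z1 i)) + complex.Im (z2 i).
  by apply/funext => i; case: (z1 i) (z2 i) => [? ?] [? ?] /=; ring.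
rewrite !rsumD ?rsumZ //; try (exact: summZ); try (apply: summD; exact: summZ).
by rewrite eq_complex /=; apply/andP; split; apply/eqP; ring.
Qed.

Lemma csum_conj z : csumm z -> csum (fun i => (z i)^*) = (csum z)^*.
Proof.
move=> [s t]; rewrite /csum; apply/eqP; rewrite eq_complex /=; apply/andP; split; apply/eqP.
  by congr rsum; apply/funext => i; case: (z i).
rewrite -mulN1r -rsumZ //; congr rsum; apply/funext => i.
by case: (z i) => ? ? /=; rewrite mulN1r.
Qed.

Lemma l2_csumm v w : csumm (fun i => v i * (w i)^*).
Proof.
apply: (csummP (psummableD (l2P v) (l2P w))) => i.
rewrite rnormM rnorm_conj /l2mass.
set x := rnorm _; set y := rnorm _; have x0 : 0 <= x by exact: rnorm_ge0.
have y0 : 0 <= y by exact: rnorm_ge0.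
by have := sqr_ge0 (x - y); nra.
Qed.

Definition l2dot v w : C := csum (fun i => v i * (w i)^*).

Lemma l2dot_conj v w : (l2dot w v)^* = l2dot v w.
Proof.
rewrite /l2dot -csum_conj; last exact: l2_csumm.
by congr csum; apply/funext => i; rewrite rmorphM /= conjCK mulrC.
Qed.

Lemma l2dot_linearl (c : C) v1 v2 w : l2dot (c *: v1 + v2) w = c * l2dot v1 w + l2dot v2 w.
Proof.
rewrite /l2dot -csumP; try exact: l2_csumm.
by congr csum; apply/funext => i; rewrite l2D l2Z mulrDl mulrA.
Qed.

Lemma l2dot_linearr (c : C) v1 v2 w : l2dot w (c *: v1 + v2) = c^* * l2dot w v1 + l2dot w v2.
Proof. by rewrite -l2dot_conj l2dot_linearl rmorphD rmorphM /= !l2dot_conj. Qed.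

Lemma l2dot_norm v : l2dot v v = (l2n v ^+ 2)%:C%C.
Proof.
have E i : v i * (v i)^* = (l2mass v i)%:C%C.
  by rewrite -normCK (rnormE (v i : C^o)) rmorphXn.
rewrite /l2dot l2n_sqr /csum; apply/eqP; rewrite eq_complex /=; apply/andP; split; apply/eqP.
  by rewrite -rsum_psum; [congr rsum; apply/funext => i; rewrite E|exact: l2P].
rewrite (_ : (fun i => _) = fun i => 0 * l2mass v i); last first.
  by apply/funext => i; rewrite E mul0r.
rewrite rsumZ ?mul0r //; apply: summ_le (l2P v) => i.
by rewrite ger0_norm // sqr_ge0.
Qed.

Fact l2dot_bilinear :
  bilinear_for (GRing.Scale.Law.clone _ _ *%R _) (GRing.Scale.Law.clone _ _ (Num.conj \; *%R) _) l2dot.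
Proof. by split=> [u|u] c v w /=; [exact: l2dot_linearl|exact: l2dot_linearr]. Qed.

HB.instance Definition _ := bilinear_isBilinear.Build C l2 l2 C _ _ l2dot l2dot_bilinear.

Fact l2dot_herm v w : l2dot v w = (-1) ^+ false * (l2dot w v)^*.
Proof. by rewrite expr0 mul1r l2dot_conj. Qed.

HB.instance Definition _ := isHermitianSesquilinear.Build C l2 false Num.conj l2dot l2dot_herm.

Fact l2dot_gt0 v : v != 0 -> 0 < l2dot v v.
Proof.
move=> v0; rewrite l2dot_norm ltcR exprn_gt0 // lt0r l2n_ge0 andbT.
by apply: contra v0 => /eqP/l2n_eq0 ->.
Qed.

HB.instance Definition _ := isDotProduct.Build C l2 l2dot l2dot_gt0.

Definition l2_space : hilbertType R.
Proof.
refine (@HilbertType R l2 l2dot _) => v.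
by rewrite [RHS]l2dot_norm rnormE rmorphXn.
Defined.

End L2Dot.

Lemma l2dot_reindex (R : realType) (L : choiceType) (e : L -> L) (v w v' w' : l2 R L) :
  bijective e -> (forall i, v' i = v (e i)) -> (forall i, w' i = w (e i)) ->
  l2dot v' w' = l2dot v w.
Proof.
move=> be vE wE; rewrite /l2dot /csum.
rewrite -(rsum_reindex (fun i => complex.Re (v i * (w i)^*)) be).
rewrite -(rsum_reindex (fun i => complex.Im (v i * (w i)^*)) be).
by congr (_ +i* _)%C; congr rsum; apply/funext => i; rewrite vE wE.
Qed.

(** * The group algebra *)

Section GroupAlg.
Context (R : realType) (L : groupType).
Local Notation C := R[i].
Implicit Types (a b c : L -> C) (h g : L).
Local Notation alg := (@group_alg R L).
Local Notation "a ** b" := (@group_conv R L a b) (at level 40, left associativity).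
Local Notation "a ^°" := (@group_star R L a) (at level 1, format "a ^°").
Local Notation delta := (@dirac_fun R L).

(** The formal combination [b] evaluated at a family of vectors: convolutions, the
operators of a representation and its induced operators are all of this form. *)
Definition group_sum (V : lmodType C) b (F : L -> V) : V :=
  \sum_(h \in [set: L]) b h *: F h.

Lemma group_sumE (V : lmodType C) b (F : L -> V) (S : set L) :
  (forall h, b h != 0 -> S h) -> group_sum b F = \sum_(h \in S) b h *: F h.
Proof.
move=> bS; symmetry; apply: fsbig_widen => // h [_ nS] /=.
by have [->|/eqP/bS//] := pselect (b h = 0); rewrite scale0r.
Qed.

Lemma group_algP (z : C) b1 b2 : alg b1 -> alg b2 -> alg (fun t => z * b1 t + b2 t).
Proof.
move=> f1 f2; apply: (@sub_finite_set _ _ ([set h | b1 h != 0] `|` [set h | b2 h != 0])); last first.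
  by rewrite finite_setU.
move=> h /=; have [->|] := eqVneq (b1 h) 0; last by left.
by rewrite mulr0 add0r; right.
Qed.

Lemma group_alg0 : alg (fun=> 0).
Proof. by apply: sub_finite_set (finite_set0 L) => h /=; rewrite eqxx. Qed.

Lemma group_alg_dirac h : alg (delta h).
Proof.
apply: sub_finite_set (finite_set1 h) => k /=; rewrite /dirac_fun.
by have [->//|_] := eqVneq k h; rewrite eqxx.
Qed.

Lemma group_algZ (z : C) b : alg b -> alg (fun t => z * b t).
Proof.
by move=> /(group_algP z)/(_ group_alg0); congr alg; apply/funext => t; rewrite addr0.
Qed.

(** The group algebra is spanned by the group elements. Identities that are
linear in an element therefore need to be checked on Dirac functions only,
where convolution is a translation. *)
Lemma group_alg_ind (P : (L -> C) -> Prop) :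
  P (fun=> 0) ->
  (forall z h b, alg b -> P b -> P (fun t => z * delta h t + b t)) ->
  forall b, alg b -> P b.
Proof.
move=> P0 PD b fb; pose s := enum_fset (fset_set [set h | b h != 0]).
suff [_] : alg (fun t => \sum_(h <- s) b h * delta h t) /\
           P (fun t => \sum_(h <- s) b h * delta h t).
  congr P; apply/funext => t; have us : uniq s by exact: fset_uniq.
  have [ts|ts] := boolP (t \in s).
    rewrite (bigD1_seq t) //= /dirac_fun eqxx mulr1 big1 ?addr0 // => h ht.
    by rewrite eq_sym (negPf ht) mulr0.
  rewrite big_seq big1 => [|h hs].
    move: ts; rewrite in_fset_set // notin_setE /= => /negP; rewrite negbK => /eqP ->.
    by [].
  rewrite /dirac_fun; have [th|_] := eqVneq t h; last by rewrite mulr0.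
  by rewrite th hs in ts.
elim: s => [|h s [IH1 IH2]].
  rewrite (_ : (fun t => _) = fun=> 0); first by split=> //; exact: group_alg0.
  by apply/funext => t; rewrite big_nil.
rewrite (_ : (fun t => _) = fun t => b h * delta h t + \sum_(h <- s) b h * delta h t).
  by split; [apply: group_algP => //; exact: group_alg_dirac|exact: PD].
by apply/funext => t; rewrite big_cons.
Qed.

Lemma group_sumP (V : lmodType C) (z : C) b1 b2 (F : L -> V) : alg b1 -> alg b2 ->
  group_sum (fun t => z * b1 t + b2 t) F = z *: group_sum b1 F + group_sum b2 F.
Proof.
move=> f1 f2; pose S := [set h | b1 h != 0] `|` [set h | b2 h != 0].
have fS : finite_set S by rewrite finite_setU.
rewrite !(@group_sumE _ _ _ S); first last.
- move=> h; have [->|n1 _] := eqVneq (b1 h) 0; last by left.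
  by rewrite mulr0 add0r => ?; right.
- by move=> h ?; left.
- by move=> h ?; right.
rewrite !fsbig_finite //= scaler_sumr -big_split /=; apply: eq_bigr => h _.
by rewrite scalerDl scalerA.
Qed.

Lemma group_sum_dirac (V : lmodType C) h (F : L -> V) : group_sum (delta h) F = F h.
Proof.
rewrite (@group_sumE _ _ _ [set h]) => [|k]; last first.
  by rewrite /dirac_fun /=; have [->|] := eqVneq k h; rewrite ?eqxx.
by rewrite fsbig_set1 /dirac_fun eqxx scale1r.
Qed.

Lemma group_sum0 (V : lmodType C) (F : L -> V) : group_sum (fun=> 0) F = 0.
Proof. by rewrite (@group_sumE _ _ _ set0) ?fsbig_set0 // => h; rewrite eqxx. Qed.

Lemma group_convE a b g : (a ** b) g = group_sum a (fun h => b (h^-1 * g)%g : C^o).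
Proof. by []. Qed.

Lemma convP (z : C) b1 b2 xi : alg b1 -> alg b2 ->
  (fun t => z * b1 t + b2 t) ** xi = fun g => z * (b1 ** xi) g + (b2 ** xi) g.
Proof. by move=> f1 f2; apply/funext => g; rewrite !group_convE group_sumP. Qed.

Lemma conv_dirac h xi : delta h ** xi = fun g => xi (h^-1 * g)%g.
Proof. by apply/funext => g; rewrite group_convE group_sum_dirac. Qed.

Lemma conv0l xi : (fun=> 0) ** xi = fun=> 0.
Proof. by apply/funext => g; rewrite group_convE group_sum0. Qed.

Lemma conv1l xi : delta 1%g ** xi = xi.
Proof. by rewrite conv_dirac; apply/funext => g; rewrite invg1 mul1g. Qed.

Lemma convPr (z : C) b x1 x2 : alg b ->
  b ** (fun t => z * x1 t + x2 t) = fun g => z * (b ** x1) g + (b ** x2) g.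
Proof.
elim/group_alg_ind=> [|w h {}b fb IH]; first by rewrite !conv0l; apply/funext => g; ring.
rewrite !convP //; try exact: group_alg_dirac.
by rewrite IH !conv_dirac; apply/funext => g; ring.
Qed.

Lemma conv0r b : alg b -> b ** (fun=> 0) = fun=> 0.
Proof.
move=> fb; apply/funext => g.
have := convPr (-1) (fun=> 0) (fun=> 0) fb => /(congr1 (@^~ g)) /=.
under eq_fun do rewrite mulr0 add0r.
by move=> ->; ring.
Qed.

Lemma dirac_shift h k : (fun g => delta k (h^-1 * g)%g) = delta (h * k)%g.
Proof.
by apply/funext => g; rewrite /dirac_fun -(inj_eq (mulgI h)) mulVKg.
Qed.

Lemma group_alg_shift h b : alg b -> alg (fun g => b (h^-1 * g)%g).
Proof.
elim/group_alg_ind=> [|w k {}b fb IHb]; first exact: group_alg0.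
rewrite (_ : (fun g => _) = fun g => w * delta (h * k)%g g + b (h^-1 * g)%g).
  by apply: group_algP => //; exact: group_alg_dirac.
by rewrite -dirac_shift.
Qed.

Lemma group_alg_conv a b : alg a -> alg b -> alg (a ** b).
Proof.
move=> + fb; elim/group_alg_ind=> [|z h {}a fa IH].
  by rewrite conv0l; exact: group_alg0.
rewrite convP //; last exact: group_alg_dirac.
by apply: group_algP => //; rewrite conv_dirac; exact: group_alg_shift.
Qed.

Lemma conv_diracA h b xi : alg b -> (delta h ** b) ** xi = delta h ** (b ** xi).
Proof.
have fd := group_alg_dirac h.
elim/group_alg_ind=> [|w k {}b fb IHb].
  by rewrite conv0r // !conv0l conv0r.
have fk := group_alg_dirac k.
rewrite convPr // convP // ?IHb; try exact: group_alg_conv.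
rewrite [in RHS]convP // convPr //.
have -> // : (delta h ** delta k) ** xi = delta h ** (delta k ** xi).
rewrite [delta h ** delta k]conv_dirac dirac_shift !conv_dirac.
by apply/funext => g; rewrite invgM mulgA.
Qed.

Lemma convA a b xi : alg a -> alg b -> (a ** b) ** xi = a ** (b ** xi).
Proof.
move=> + fb; elim/group_alg_ind=> [|z h {}a fa IH]; first by rewrite !conv0l.
have fd := group_alg_dirac h.
rewrite !convP //; try exact: group_alg_conv.
by rewrite IH conv_diracA.
Qed.

Lemma star_dirac h : (delta h)^° = delta h^-1%g.
Proof.
apply/funext => g; rewrite /group_star /dirac_fun -(inj_eq invg_inj) invgK.
by case: eqP => _; rewrite ?rmorph1 ?rmorph0.
Qed.

Lemma starP (z : C) b1 b2 :
  (fun t => z * b1 t + b2 t)^° = fun t => z^* * b1^° t + b2^° t.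
Proof. by apply/funext => g; rewrite /group_star rmorphD rmorphM. Qed.

Lemma star0 : (fun=> 0 : C)^° = fun=> 0.
Proof. by apply/funext => g; rewrite /group_star rmorph0. Qed.

Lemma starK b : b^°^° = b.
Proof. by apply/funext => g; rewrite /group_star invgK conjCK. Qed.

Lemma group_alg_star b : alg b -> alg b^°.
Proof.
elim/group_alg_ind=> [|z h {}b fb IH]; first by rewrite star0; exact: group_alg0.
by rewrite starP star_dirac; apply: group_algP => //; exact: group_alg_dirac.
Qed.

Lemma conv_diracr b k : alg b -> b ** delta k = fun g => b (g * k^-1)%g.
Proof.
elim/group_alg_ind=> [|z h {}b fb IH]; first by rewrite conv0l.
rewrite convP ?IH //; last exact: group_alg_dirac.
rewrite conv_dirac; apply/funext => g; congr (z * _ + _).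
by rewrite /dirac_fun -(inj_eq (mulgI h)) mulVKg -[in RHS](inj_eq (mulIg k)) mulgVK.
Qed.

Lemma conv1r b : alg b -> b ** delta 1%g = b.
Proof. by move=> fb; rewrite conv_diracr //; apply/funext => g; rewrite invg1 mulg1. Qed.

Lemma star_conv a b : alg a -> alg b -> (a ** b)^° = b^° ** a^°.
Proof.
move=> + fb; elim/group_alg_ind=> [|z h {}a fa IH].
  by rewrite conv0l !star0 conv0r //; exact: group_alg_star.
have fd := group_alg_dirac h; have fb' := group_alg_star fb.
rewrite convP // !starP convPr // IH.
suff -> : (delta h ** b)^° = b^° ** (delta h)^° by [].
rewrite star_dirac conv_dirac conv_diracr //; apply/funext => g.
by rewrite /group_star invgK invgM.
Qed.

End GroupAlg.

(** * Bernstein polynomials of a truncation, with positivity certificates *)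

Section Bernstein.
Context (R : realType).
Implicit Types (p q : {poly R}) (f g : nat -> {poly R}).

(** The sum of C(n,k) X^k (1-X)^(n-k) f(k) over k, by Pascal's rule. The recursion
makes it evident that the weights are products of X and 1 - X and add up to 1,
without any manipulation of binomial coefficients. The samples f(k) may be
polynomials themselves, as in the estimates below, where X occurs in them. *)
Fixpoint bernstein (n : nat) f : {poly R} :=
  if n is n'.+1 then (1 - 'X) * bernstein n' f + 'X * bernstein n' (fun k => f k.+1)
  else f 0%N.

Lemma bernsteinD n f g : bernstein n (fun k => f k + g k) = bernstein n f + bernstein n g.
Proof.
elim: n f g => [|n IH] f g //=.
by rewrite IH (IH (fun k => f k.+1)); ring.
Qed.

Lemma bernsteinM n p f : bernstein n (fun k => p * f k) = p * bernstein n f.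
Proof.
elim: n f => [|n IH] f //=.
by rewrite IH (IH (fun k => f k.+1)); ring.
Qed.

Lemma bernsteinN n f : bernstein n (fun k => - f k) = - bernstein n f.
Proof.
rewrite -mulN1r -bernsteinM; congr (bernstein n _).
by apply/funext => k; rewrite mulN1r.
Qed.

Lemma bernsteinB n f g : bernstein n (fun k => f k - g k) = bernstein n f - bernstein n g.
Proof. by rewrite bernsteinD bernsteinN. Qed.

Lemma bernstein_cst n p : bernstein n (fun=> p) = p.
Proof. by elim: n => [|n IH] //=; rewrite IH; ring. Qed.

Lemma bernstein_id n : bernstein n (fun k => k%:R) = n%:R * 'X.
Proof.
elim: n => [|n IH] /=; first by rewrite mul0r.
under [in X in _ + X]eq_fun do rewrite -natr1.
by rewrite bernsteinD bernstein_cst IH -natr1; ring.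
Qed.

Lemma bernstein_sqr n :
  bernstein n (fun k => k%:R ^+ 2) = n%:R * ('X * (1 - 'X)) + n%:R ^+ 2 * 'X ^+ 2.
Proof.
elim: n => [|n IH] /=; first by rewrite expr0n /=; ring.
rewrite (_ : (fun k => k.+1%:R ^+ 2) = fun k => (k%:R ^+ 2 + 2 * k%:R) + 1); last first.
  by apply/funext => k; rewrite -natr1; ring.
by rewrite !bernsteinD bernstein_cst bernsteinM bernstein_id IH -natr1; ring.
Qed.

Definition node (n k : nat) : R := k%:R / n.+1%:R.

Lemma bernstein_node n : bernstein n.+1 (fun k => (node n k)%:P) = 'X.
Proof.
rewrite (_ : (fun k => _) = fun k => (n.+1%:R^-1)%:P * k%:R); last first.
  by apply/funext => k; rewrite /node mulrC polyCM -polyC_natr.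
by rewrite bernsteinM bernstein_id mulrA -polyC_natr -polyCM mulVf ?mul1r.
Qed.

(** With [bernstein_node], this says that the weights have variance X(1-X)/n about
their mean X. *)
Lemma bernstein_node_sqr n :
  bernstein n.+1 (fun k => (node n k)%:P ^+ 2) = (n.+1%:R^-1)%:P * ('X * (1 - 'X)) + 'X ^+ 2.
Proof.
rewrite (_ : (fun k => _) = fun k => (n.+1%:R^-1)%:P ^+ 2 * k%:R ^+ 2); last first.
  by apply/funext => k; rewrite /node mulrC polyCM -polyC_natr exprMn.
have E : (n.+1%:R^-1)%:P * n.+1%:R = 1 :> {poly R}.
  by rewrite -polyC_natr -polyCM mulVf.
rewrite bernsteinM bernstein_sqr; set c := _%:P in E *; set N := n.+1%:R in E *.
rewrite (_ : c ^+ 2 * _ = (c * N) * (c * ('X * (1 - 'X))) + (c * N) ^+ 2 * 'X ^+ 2).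
  by rewrite E; ring.
by ring.
Qed.

Definition node_trunc (c : R) n k : R := Num.max (node n k - c) 0.

Definition bernstein_trunc (c : R) n : {poly R} := bernstein n.+1 (fun k => (node_trunc c n k)%:P).

(** Polynomials that are certified to be positive by a sum of squares; [cone_norm]
and the lemmas after it are the weighted identities which replace reasoning on
the spectrum. *)
Record poly_cone (K : {poly R} -> Prop) : Prop := PolyCone {
  cone1 : K 1;
  coneD : forall p q, K p -> K q -> K (p + q);
  coneZ : forall (c : R) p, 0 <= c -> K p -> K (c%:P * p);
  cone_sqr : forall p q, K p -> K (q ^+ 2 * p)
}.

Section Cone.
Context (K : {poly R} -> Prop) (hK : poly_cone K).

Lemma coneC (c : R) : 0 <= c -> K c%:P.
Proof. by move=> c0; rewrite -[c%:P]mulr1; apply: (coneZ hK) => //; exact: cone1. Qed.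

Lemma cone_square q : K (q ^+ 2).
Proof. by rewrite -[_ ^+ 2]mulr1; apply: (cone_sqr hK); exact: cone1. Qed.

(** q^2 - p^2 = ((q-p)^2 (q+p) + (q+p)^2 (q-p)) / 2q. It turns the order bounds
-q <= p <= q into a bound of the operator norm. *)
Lemma cone_norm (q : R) p : 0 < q -> K (q%:P - p) -> K (q%:P + p) -> K ((q ^+ 2)%:P - p ^+ 2).
Proof.
move=> q0 h1 h2.
have E : (2 * q)^-1%:P * 2 * q%:P = 1 :> {poly R}.
  by rewrite -polyC_natr -!polyCM -mulrA mulVf // mulf_neq0 // gt_eqF.
rewrite (_ : _ - _ = (2 * q)^-1%:P * ((q%:P - p) ^+ 2 * (q%:P + p) + (q%:P + p) ^+ 2 * (q%:P - p))).
  apply: (coneZ hK); first by rewrite invr_ge0 mulr_ge0 // ltW.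
  by apply: (coneD hK); exact: (cone_sqr hK).
set i := _%:P in E *; rewrite polyC_exp.
rewrite (_ : i * _ = (i * 2 * q%:P) * (q%:P ^+ 2 - p ^+ 2)); last by ring.
by rewrite E mul1r.
Qed.

(** X(c-X) = (X^2 (c-X) + (c-X)^2 X) / c. *)
Lemma cone_mulX (c : R) : 0 < c -> K 'X -> K (c%:P - 'X) -> K ('X * (c%:P - 'X)).
Proof.
move=> c0 h1 h2.
have E : c^-1%:P * c%:P = 1 :> {poly R} by rewrite -polyCM mulVf // gt_eqF.
rewrite (_ : _ * _ = c^-1%:P * ('X ^+ 2 * (c%:P - 'X) + (c%:P - 'X) ^+ 2 * 'X)).
  apply: (coneZ hK); first by rewrite invr_ge0 // ltW.
  by apply: (coneD hK); exact: (cone_sqr hK).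
rewrite (_ : c^-1%:P * _ = (c^-1%:P * c%:P) * ('X * (c%:P - 'X))); last by ring.
by rewrite E mul1r.
Qed.

(** The polynomials that stay in the cone after multiplication by any Bernstein
weight. A cone need not be stable under products, and this is the stability
that makes Bernstein operators positive. *)
Definition bcone q := forall i j, K ('X ^+ i * (1 - 'X) ^+ j * q).

Lemma bernstein_bcone n f : (forall k, bcone (f k)) -> bcone (bernstein n f).
Proof.
elim: n f => [|n IH] f fK i j /=; first exact: fK.
rewrite mulrDr; apply: (coneD hK).
  rewrite (_ : _ * _ = 'X ^+ i * (1 - 'X) ^+ j.+1 * bernstein n f); first exact: IH.
  by rewrite exprS; ring.
rewrite (_ : _ * _ = 'X ^+ i.+1 * (1 - 'X) ^+ j * bernstein n (fun k => f k.+1)).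
  by apply: IH => k; exact: fK.
by rewrite exprS; ring.
Qed.

Lemma bconeW q : bcone q -> K q.
Proof. by move=> /(_ 0%N 0%N); rewrite !expr0 !mul1r. Qed.

Lemma bconeD p q : bcone p -> bcone q -> bcone (p + q).
Proof. by move=> hp hq i j; rewrite mulrDr; apply: (coneD hK). Qed.

Lemma bconeZ (c : R) q : 0 <= c -> bcone q -> bcone (c%:P * q).
Proof. by move=> c0 h i j; rewrite mulrCA; apply: (coneZ hK). Qed.

Lemma bcone_sqr p q : bcone p -> bcone (q ^+ 2 * p).
Proof. by move=> h i j; rewrite mulrCA; apply: (cone_sqr hK). Qed.

(** Even powers are squares, so that only the parities of the exponents matter. *)
Lemma bcone_parity q : K q -> K ('X * q) -> K ((1 - 'X) * q) -> K ('X * (1 - 'X) * q) ->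
  bcone q.
Proof.
move=> h h1 h2 h3 i j.
have E (x : {poly R}) k : x ^+ k = x ^+ odd k * (x ^+ k./2) ^+ 2.
  by rewrite -exprM -exprD muln2 odd_double_half.
rewrite (E 'X) (E (1 - 'X)).
rewrite (_ : _ * q = ('X ^+ i./2 * (1 - 'X) ^+ j./2) ^+ 2 *
    ('X ^+ (odd i) * (1 - 'X) ^+ (odd j) * q)); last by ring.
by apply: (cone_sqr hK); case: (odd i) (odd j) => [] [];
  rewrite ?expr0 ?expr1 ?mul1r ?mulr1.
Qed.

Hypotheses (KX : K 'X) (K1X : K (1 - 'X)).

Lemma bcone1 : bcone 1.
Proof.
apply: bcone_parity; rewrite ?mulr1 //; first exact: cone1.
by have := @cone_mulX 1; apply.
Qed.

Lemma bconeC (c : R) : 0 <= c -> bcone c%:P.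
Proof. by move=> c0; rewrite -[c%:P]mulr1; apply: bconeZ => //; exact: bcone1. Qed.

Lemma bcone_subX (c : R) : 0 < c -> c <= 1 -> K (c%:P - 'X) -> bcone (c%:P - 'X).
Proof.
move=> c0 c1 h; have hX := cone_mulX c0 KX h.
have c1' : 0 <= 1 - c by rewrite subr_ge0.
apply: bcone_parity => //.
  rewrite (_ : _ * _ = (1 - c)%:P * (c%:P - 'X) + (c%:P - 'X) ^+ 2).
    by apply: (coneD hK); [exact: (coneZ hK)|exact: cone_square].
  by rewrite polyCB; ring.
rewrite (_ : _ * _ = (1 - c)%:P * ('X * (c%:P - 'X)) + (c%:P - 'X) ^+ 2 * 'X).
  by apply: (coneD hK); [exact: (coneZ hK)|exact: (cone_sqr hK)].
by rewrite polyCB; ring.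
Qed.

Lemma cone_quarter : K ((4^-1)%:P - 'X * (1 - 'X)).
Proof.
rewrite (_ : _ - _ = ('X - (2^-1)%:P) ^+ 2); first exact: cone_square.
have E2 : (2^-1)%:P * 2 = 1 :> {poly R} by rewrite -polyC_natr -polyCM mulVf.
have -> : (4^-1)%:P = (2^-1)%:P ^+ 2 :> {poly R}.
  by rewrite -polyC_exp; congr polyC; field.
rewrite (_ : ('X - (2^-1)%:P) ^+ 2 = 'X ^+ 2 - (2^-1)%:P * 2 * 'X + (2^-1)%:P ^+ 2); last by ring.
by rewrite E2; ring.
Qed.

Lemma bernstein_trunc_bcone (c : R) n : bcone (bernstein_trunc c n).
Proof. by apply: bernstein_bcone => k; apply: bconeC; rewrite le_max lexx orbT. Qed.

Lemma bernstein_trunc_ge (c : R) n : K (bernstein_trunc c n - ('X - c%:P)).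
Proof.
rewrite -[in X in _ - (X - _)](bernstein_node n) -[c%:P in X in _ - X](bernstein_cst n.+1) -bernsteinB -bernsteinB.
apply/bconeW/bernstein_bcone => k; rewrite -!polyCB; apply: bconeC.
by rewrite subr_ge0 le_max lexx.
Qed.

(** On a spectrum contained in [0,c] the truncation vanishes, and its Bernstein
polynomial is small. For s a node and t <= c,
max(s-c,0) <= max(s-t,0) <= e/2 + (s-t)^2/2e by the inequality of the means; the
average of (s-t)^2 over the nodes is the variance t(1-t)/(n+1), at most
1/4(n+1). *)
Lemma bernstein_trunc_small (c e : R) n : 0 < c -> c <= 1 -> 0 < e -> K (c%:P - 'X) ->
  K ((e / 2 + (8 * e * n.+1%:R)^-1)%:P - bernstein_trunc c n).
Proof.
move=> c0 c1 e0 Kc.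
(* [g k] is the difference of the two sides at the node [k], with [c - X] in
   the role of the nonnegative number c - t. For s > c it is the sum of
   (e - (s - X))^2 / 2e and c - X. *)
pose g k : {poly R} := (e / 2)%:P + ((2 * e)^-1)%:P * ((node n k)%:P - 'X) ^+ 2 - (node_trunc c n k)%:P.
have E2 : (2 * e)^-1%:P * 2 * e%:P = 1 :> {poly R}.
  by rewrite -polyC_natr -!polyCM -mulrA mulVf // mulf_neq0 // gt_eqF.
have i0 : 0 <= (2 * e)^-1 by rewrite invr_ge0 mulr_ge0 // ltW.
have hg k : bcone (g k).
  rewrite /g /node_trunc; set s := node n k.
  have [sc|sc] := leP (s - c) 0.
    rewrite subr0; apply: bconeD; first by apply: bconeC; rewrite divr_ge0 // ltW.
    by apply: bconeZ => //; rewrite -[_ ^+ 2]mulr1; apply: bcone_sqr; exact: bcone1.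
  rewrite (_ : _ - _ = (2 * e)^-1%:P * ((e%:P - (s%:P - 'X)) ^+ 2) + (c%:P - 'X)).
    apply: bconeD; last exact: bcone_subX.
    by apply: bconeZ => //; rewrite -[_ ^+ 2]mulr1; apply: bcone_sqr; exact: bcone1.
  have -> : (e / 2)%:P = (2 * e)^-1%:P * e%:P ^+ 2 :> {poly R}.
    by rewrite -polyC_exp -polyCM; congr polyC; field; rewrite gt_eqF.
  rewrite polyCB.
  rewrite (_ : (2 * e)^-1%:P * (e%:P - (s%:P - 'X)) ^+ 2 =
    (2 * e)^-1%:P * e%:P ^+ 2 - ((2 * e)^-1%:P * 2 * e%:P) * (s%:P - 'X) +
    (2 * e)^-1%:P * (s%:P - 'X) ^+ 2); last by ring.
  by rewrite E2; ring.
have := bconeW (@bernstein_bcone n.+1 g hg).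
rewrite /g bernsteinB bernsteinD bernstein_cst bernsteinM -/(bernstein_trunc c n).
have -> : bernstein n.+1 (fun k => ((node n k)%:P - 'X) ^+ 2) = n.+1%:R^-1%:P * ('X * (1 - 'X)).
  rewrite (_ : (fun k => _) = fun k => (node n k)%:P ^+ 2 + ((- 2 * 'X) * (node n k)%:P + 'X ^+ 2)).
    by rewrite !bernsteinD bernsteinM bernstein_node_sqr bernstein_node bernstein_cst; ring.
  by apply/funext => k; ring.
move=> h; rewrite (_ : _ - _ =
  ((2 * e)^-1 * n.+1%:R^-1)%:P * ((4^-1)%:P - 'X * (1 - 'X)) +
  ((e / 2)%:P + (2 * e)^-1%:P * (n.+1%:R^-1%:P * ('X * (1 - 'X))) - bernstein_trunc c n)).
  apply: (coneD hK) => //; apply: (coneZ hK); last exact: cone_quarter.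
  by rewrite mulr_ge0 // invr_ge0.
have -> : (e / 2 + (8 * e * n.+1%:R)^-1)%:P = (e / 2)%:P + ((2 * e)^-1 * n.+1%:R^-1)%:P * (4^-1)%:P :> {poly R}.
  rewrite -polyCM -polyCD; congr polyC.
  have : n.+1%:R != 0 :> R by rewrite pnatr_eq0.
  by move: (n.+1%:R) => N N0; field; rewrite N0 gt_eqF.
by rewrite polyCM; ring.
Qed.

(** Average |max(s-c,0) - max(t-c,0)| <= |s-t| <= e/2 + (s-t)^2/2e over pairs of
nodes, with the weights of both polynomials: by independence the average of
(s-t)^2 is the sum of the variances. *)
Lemma bernstein_trunc_close (c e : R) m n : 0 < e ->
  K ((e / 2 + (m.+1%:R^-1 + n.+1%:R^-1) / (8 * e))%:P - (bernstein_trunc c m - bernstein_trunc c n)).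
Proof.
move=> e0.
pose g k l : {poly R} := (e / 2)%:P + ((2 * e)^-1)%:P * ((node m k)%:P - (node n l)%:P) ^+ 2
  - ((node_trunc c m k)%:P - (node_trunc c n l)%:P).
have i0 : 0 <= (2 * e)^-1 by rewrite invr_ge0 mulr_ge0 // ltW.
have hg k l : bcone (g k l).
  rewrite /g -!polyCB -polyC_exp -polyCM -polyCD -polyCB; apply: bconeC.
  rewrite /node_trunc; set s := node m k; set t := node n l.
  have le1 : Num.max (s - c) 0 - Num.max (t - c) 0 <= `|s - t|.
    have := ler_norm (s - t); have := normr_ge0 (s - t).
    by have [] := leP (s - c) 0; have [] := leP (t - c) 0; lra.
  have := sqr_ge0 (e - `|s - t|).
  rewrite -[(s - t) ^+ 2]real_normK ?num_real //; move: le1; set w := `|s - t|; set d := _ - Num.max _ _.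
  move=> le1 le2; rewrite (_ : _ - d = (2 * e)^-1 * (e - w) ^+ 2 + (w - d)).
    by rewrite addr_ge0 // ?subr_ge0 // mulr_ge0.
  by field; rewrite gt_eqF.
have := bconeW (@bernstein_bcone m.+1 (fun k => bernstein n.+1 (g k)) (fun k => bernstein_bcone n.+1 (hg k))).
have E1 k : bernstein n.+1 (g k) = ((e / 2)%:P + (2 * e)^-1%:P *
    (n.+1%:R^-1%:P * ('X * (1 - 'X)) + ((node m k)%:P - 'X) ^+ 2)) - ((node_trunc c m k)%:P - bernstein_trunc c n).
  rewrite /g !bernsteinB bernsteinD !bernstein_cst bernsteinM -/(bernstein_trunc c n); congr (_ + _ * _ - _).
  rewrite (_ : (fun l => _) = fun l => (node n l)%:P ^+ 2 +
      ((- 2 * (node m k)%:P) * (node n l)%:P + (node m k)%:P ^+ 2)); last first.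
    by apply/funext => l; ring.
  by rewrite !bernsteinD bernsteinM bernstein_node_sqr bernstein_node bernstein_cst; ring.
rewrite (funext E1).
rewrite !bernsteinB !bernsteinD !bernstein_cst bernsteinM bernsteinD bernstein_cst -/(bernstein_trunc c m).
have -> : bernstein m.+1 (fun k => ((node m k)%:P - 'X) ^+ 2) = m.+1%:R^-1%:P * ('X * (1 - 'X)).
  rewrite (_ : (fun k => _) = fun k => (node m k)%:P ^+ 2 + ((- 2 * 'X) * (node m k)%:P + 'X ^+ 2)).
    by rewrite !bernsteinD bernsteinM bernstein_node_sqr bernstein_node bernstein_cst; ring.
  by apply/funext => k; ring.
move=> h; rewrite (_ : _ - _ =
  ((2 * e)^-1 * (m.+1%:R^-1 + n.+1%:R^-1))%:P * ((4^-1)%:P - 'X * (1 - 'X)) +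
  ((e / 2)%:P + (2 * e)^-1%:P * (n.+1%:R^-1%:P * ('X * (1 - 'X)) +
    m.+1%:R^-1%:P * ('X * (1 - 'X))) - (bernstein_trunc c m - bernstein_trunc c n))).
  apply: (coneD hK) => //; apply: (coneZ hK); last exact: cone_quarter.
  by rewrite mulr_ge0 // addr_ge0 // invr_ge0.
have -> : (e / 2 + (m.+1%:R^-1 + n.+1%:R^-1) / (8 * e))%:P = (e / 2)%:P +
    ((2 * e)^-1 * (m.+1%:R^-1 + n.+1%:R^-1))%:P * (4^-1)%:P :> {poly R}.
  rewrite -polyCM -polyCD; congr polyC.
  by move: (m.+1%:R^-1) (n.+1%:R^-1) => x y; field; rewrite gt_eqF.
by rewrite [((2 * e)^-1 * _)%:P]polyCM polyCD; ring.
Qed.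

End Cone.
End Bernstein.

(** * Polynomials of a symmetric operator *)

Section PolyOperator.
Context (R : realType) (V : lmodType R[i]) (T : V -> V).
Hypothesis T_lin : linear T.
Implicit Types (p q : {poly R}) (v w : V).

Definition poly_oper p v : V := \sum_(i < size p) (p`_i)%:C%C *: iter i T v.

Lemma linear_mapD v w : T (v + w) = T v + T w.
Proof. by have := T_lin 1 v w; rewrite !scale1r. Qed.

Lemma linear_map0 : T 0 = 0.
Proof. by have := T_lin (-1) 0 0; rewrite !scaleN1r oppr0 addr0 addNr. Qed.

Lemma linear_mapZ (z : R[i]) v : T (z *: v) = z *: T v.
Proof. by have := T_lin z v 0; rewrite !addr0 linear_map0 addr0. Qed.

Lemma linear_map_sum n (F : 'I_n -> V) : T (\sum_(i < n) F i) = \sum_(i < n) T (F i).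
Proof. by rewrite (big_morph T linear_mapD linear_map0). Qed.

Lemma poly_oper_widen n p v : (size p <= n)%N ->
  poly_oper p v = \sum_(i < n) (p`_i)%:C%C *: iter i T v.
Proof.
move=> pn; rewrite /poly_oper (big_ord_widen n (fun i => (p`_i)%:C%C *: iter i T v) pn).
rewrite big_mkcond /=; apply: eq_bigr => i _; case: ifPn => //.
by rewrite -leqNgt => /(nth_default 0) ->; rewrite scale0r.
Qed.

Lemma poly_operD p q v : poly_oper (p + q) v = poly_oper p v + poly_oper q v.
Proof.
pose n := maxn (size p) (size q).
rewrite !(@poly_oper_widen n) ?size_polyD ?leq_maxl ?leq_maxr //.
by rewrite -big_split /=; apply: eq_bigr => i _; rewrite coefD rmorphD scalerDl.
Qed.

Lemma poly_operZ (c : R) p v : poly_oper (c%:P * p) v = c%:C%C *: poly_oper p v.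
Proof.
rewrite mul_polyC !(@poly_oper_widen (size p)) ?size_scale_leq //.
by rewrite scaler_sumr; apply: eq_bigr => i _; rewrite coefZ rmorphM scalerA.
Qed.

Lemma poly_oper0 v : poly_oper 0 v = 0.
Proof. by rewrite /poly_oper size_poly0 big_ord0. Qed.

Lemma poly_oper1 v : poly_oper 1 v = v.
Proof. by rewrite /poly_oper size_poly1 big_ord1 coef1 scale1r. Qed.

Lemma poly_operC (c : R) v : poly_oper c%:P v = c%:C%C *: v.
Proof. by rewrite -[c%:P]mulr1 poly_operZ poly_oper1. Qed.

Lemma poly_operXM p v : poly_oper ('X * p) v = T (poly_oper p v).
Proof.
rewrite (@poly_oper_widen (size p).+1); last by rewrite (leq_trans (size_polyMleq _ _)) // size_polyX.
rewrite big_ord_recl coefXM scale0r add0r (@poly_oper_widen (size p) p) // linear_map_sum.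
by apply: eq_bigr => i _; rewrite coefXM linear_mapZ.
Qed.

Lemma poly_operX v : poly_oper 'X v = T v.
Proof. by rewrite -['X]mulr1 poly_operXM poly_oper1. Qed.

Lemma poly_oper_comm p v : poly_oper p (T v) = T (poly_oper p v).
Proof.
rewrite /poly_oper linear_map_sum; apply: eq_bigr => i _.
by rewrite linear_mapZ -iterSr.
Qed.

Lemma poly_operM p q v : poly_oper (p * q) v = poly_oper p (poly_oper q v).
Proof.
elim/poly_ind: p v q => [|p c IH] v q; first by rewrite mul0r !poly_oper0.
rewrite mulrDl !poly_operD poly_operZ poly_operC -mulrA IH poly_operXM poly_oper_comm.
by rewrite [p * 'X]mulrC poly_operXM.
Qed.

Lemma poly_operB p q v : poly_oper (p - q) v = poly_oper p v - poly_oper q v.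
Proof.
rewrite poly_operD -[- q]mulN1r -polyCN poly_operZ rmorphN /= scaleNr.
by rewrite -[1%:C%C]/(1 : R[i]) scale1r.
Qed.

Context (H : hilbertType R) (D : set V) (Phi : V -> H).
Hypothesis D_lin : forall (z : R[i]) v w, D v -> D w -> D (z *: v + w).
Hypothesis D0 : D 0.
Hypothesis TD : forall v, D v -> D (T v).
Hypothesis Phi_lin : forall (z : R[i]) v w, D v -> D w -> Phi (z *: v + w) = z *: Phi v + Phi w.
Hypothesis T_sym : forall v w, D v -> D w -> hdot H (Phi (T v)) (Phi w) = hdot H (Phi v) (Phi (T w)).

Lemma domZ (z : R[i]) v : D v -> D (z *: v).
Proof. by move=> Dv; rewrite -[_ *: _]addr0; apply: D_lin. Qed.
Lemma domD v w : D v -> D w -> D (v + w).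
Proof. by move=> Dv Dw; rewrite -[v]scale1r; apply: D_lin. Qed.

Lemma poly_oper_dom p v : D v -> D (poly_oper p v).
Proof.
move=> Dv; elim/poly_ind: p => [|p c IH]; first by rewrite poly_oper0.
by rewrite poly_operD [p * _]mulrC poly_operXM poly_operC; apply: domD; [exact: TD|exact: domZ].
Qed.

Lemma PhiD v w : D v -> D w -> Phi (v + w) = Phi v + Phi w.
Proof. by move=> Dv Dw; rewrite -[v]scale1r Phi_lin // !scale1r. Qed.

Lemma Phi0 : Phi 0 = 0.
Proof. by have := Phi_lin (-1) D0 D0; rewrite !scaleN1r oppr0 addr0 addNr. Qed.

Lemma PhiZ (z : R[i]) v : D v -> Phi (z *: v) = z *: Phi v.
Proof. by move=> Dv; rewrite -[_ *: v]addr0 Phi_lin // Phi0 addr0. Qed.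

Lemma poly_oper_sym p v w : D v -> D w ->
  hdot H (Phi (poly_oper p v)) (Phi w) = hdot H (Phi v) (Phi (poly_oper p w)).
Proof.
move=> Dv Dw; elim/poly_ind: p v w Dv Dw => [|p c IH] v w Dv Dw.
  by rewrite !poly_oper0 Phi0 linear0l linear0r.
have Dp := poly_oper_dom p Dv; have Dp' := poly_oper_dom p Dw.
rewrite !poly_operD [p * _]mulrC !poly_operXM !poly_operC !PhiD; try exact: TD; try exact: domZ.
rewrite !PhiZ // linearDl linearDr linearZl_LR linearZr_LR /= T_sym //.
rewrite IH ?poly_oper_comm //; last exact: TD.
by rewrite conj_Creal // complex_real.
Qed.

(** Positivity is tested through [Phi] on [D] only: the operator acts on the domain
of [Phi], for instance on a group algebra, and need not be bounded or even
well defined on the Hilbert space. *)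
Definition oper_cone p := forall v, D v -> 0 <= hdot H (Phi (poly_oper p v)) (Phi v).

(** A symmetric operator commutes with its polynomials, so that
<q^2 p v, v> = <p (q v), q v>. *)
Lemma oper_coneP : poly_cone oper_cone.
Proof.
split=> [v Dv|p q hp hq v Dv|c p c0 hp v Dv|p q hp v Dv].
- by rewrite poly_oper1 dnorm_ge0.
- rewrite poly_operD PhiD; try exact: poly_oper_dom.
  by rewrite linearDl addr_ge0 ?hp ?hq.
- rewrite poly_operZ PhiZ; last exact: poly_oper_dom.
  by rewrite linearZl_LR mulr_ge0 ?hp // lecR.
- have -> : q ^+ 2 * p = q * (p * q) by ring.
  have Dq := poly_oper_dom q Dv.
  rewrite poly_operM poly_oper_sym //; last exact: poly_oper_dom.
  by rewrite poly_operM; exact: hp.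
Qed.

Lemma hdot_rnorm (v : H) : hdot H v v = (rnorm v ^+ 2)%:C%C.
Proof. by rewrite -hdot_norm rnormE rmorphXn. Qed.

Lemma oper_cone_norm (q : R) p v : 0 <= q -> oper_cone ((q ^+ 2)%:P - p ^+ 2) -> D v ->
  rnorm (Phi (poly_oper p v)) <= q * rnorm (Phi v).
Proof.
move=> q0 hp Dv; have := hp v Dv.
have Dp := poly_oper_dom p Dv.
have Dpp := poly_oper_dom (p ^+ 2) Dv.
rewrite poly_operB poly_operC -scaleN1r addrC Phi_lin // ?PhiZ //; last exact: domZ.
rewrite linearDl !linearZl_LR /= [p ^+ 2]expr2 poly_operM poly_oper_sym // !hdot_rnorm.
rewrite mulN1r -rmorphM -rmorphN -rmorphD /= lecR => h.
rewrite -(@ler_pXn2r _ 2) ?nnegrE ?mulr_ge0 ?rnorm_ge0 //.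
by rewrite exprMn; lra.
Qed.

End PolyOperator.

(** * Truncations in the group algebra *)

Section Covariant.
Context (R : realType) (L : groupType).
Local Notation C := R[i].
Local Notation alg := (@group_alg R L).
Local Notation "a ** b" := (@group_conv R L a b) (at level 40, left associativity).
Local Notation "a ^°" := (@group_star R L a) (at level 1, format "a ^°").
Local Notation delta := (@dirac_fun R L).

(** The common features of b |-> rho(b)v for a representation rho of the group
algebra, of b |-> b * v in l^2, and of b |-> pi(b (x) u)v for a representation pi
of the groupoid algebra. For the last one, this notion makes it possible to argue as
if pi extended to a representation of the group algebra. *)
Record covariant (H : hilbertType R) (Phi : (L -> C) -> H) : Prop := Covariant {
  cov_lin : forall (z : C) b1 b2, alg b1 -> alg b2 ->
    Phi (fun t => z * b1 t + b2 t) = z *: Phi b1 + Phi b2;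
  cov_star : forall a b b', alg a -> alg b -> alg b' ->
    hdot H (Phi (a ** b)) (Phi b') = hdot H (Phi b) (Phi (a^° ** b'))
}.

Lemma cov0 (H : hilbertType R) (Phi : (L -> C) -> H) : covariant Phi -> Phi (fun=> 0) = 0.
Proof.
move=> covP; have := cov_lin covP (-1) (@group_alg0 R L) (@group_alg0 R L).
by under eq_fun do rewrite mulr0 addr0; rewrite scaleN1r addNr.
Qed.

(** Group elements act isometrically, as h*h = 1. *)
Lemma cov_dirac (H : hilbertType R) (Phi : (L -> C) -> H) h b : covariant Phi -> alg b ->
  rnorm (Phi (delta h ** b)) = rnorm (Phi b).
Proof.
move=> covP fb; have fd := group_alg_dirac R h.
apply/eqP; rewrite -(@eqrXn2 _ 2) ?rnorm_ge0 //; apply/eqP/complexI.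
rewrite -!hdot_rnorm (cov_star covP) //; last exact: group_alg_conv.
by rewrite -convA ?star_dirac ?conv_dirac ?dirac_shift ?mulVg ?conv1l //; exact: group_alg_dirac.
Qed.

(** The l^1 norm bounds an element in all representations at once. *)
Lemma cov_bound a : alg a -> exists N : R, 0 <= N /\
  forall (H : hilbertType R) (Phi : (L -> C) -> H), covariant Phi ->
  forall b, alg b -> rnorm (Phi (a ** b)) <= N * rnorm (Phi b).
Proof.
elim/group_alg_ind => [|z h {}a fa [N [N0 IH]]].
  exists 0; split=> // H Phi covP b _; rewrite conv0l cov0 // rnorm0.
  by rewrite mul0r.
exists (rnorm (z : C^o) + N); split; first by rewrite addr_ge0 ?rnorm_ge0.
move=> H Phi covP b fb; have fd := group_alg_dirac R h.
rewrite convP // (cov_lin covP); try exact: group_alg_conv.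
apply: (le_trans (rnormD _ _)); rewrite rnormZ cov_dirac // mulrDl.
by rewrite lerD2l IH.
Qed.

(** Cauchy-Schwarz, obtained by expanding the square of the triangle inequality. *)
Lemma hdot_le (H : hilbertType R) (v w : H) : complex.Re (hdot H v w) <= rnorm v * rnorm w.
Proof.
have : rnorm (v + w) ^+ 2 <= (rnorm v + rnorm w) ^+ 2.
  by rewrite ler_pXn2r ?nnegrE ?addr_ge0 ?rnorm_ge0 ?rnormD.
have : (rnorm (v + w) ^+ 2)%:C%C = ((rnorm v) ^+ 2)%:C%C + ((rnorm w) ^+ 2)%:C%C +
    (hdot H v w + (hdot H v w)^*).
  by rewrite -!hdot_rnorm dnormD.
move=> /(congr1 (@complex.Re R)); rewrite !raddfD /=.
have -> : complex.Re (hdot H v w)^* = complex.Re (hdot H v w) by case: (hdot H v w).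
by move=> ->; nra.
Qed.

Section Truncation.
Context (a : L -> C) (fa : alg a) (M c : R) (M0 : 0 < M) (c0 : 0 < c) (c1 : c <= 1).

(** Multiplication by a*a/M, which has its spectrum in [0,1] when M bounds a*a. *)
Definition sqop (b : L -> C^o) : L -> C^o := (M^-1)%:C%C *: ((a^° ** (a ** b)) : L -> C^o).

Definition trunc_alg n : L -> C := poly_oper sqop (bernstein_trunc c n) (delta 1%g).

Let fas := group_alg_star fa.

Lemma sqop_lin : linear sqop.
Proof.
move=> z v w; rewrite /sqop -[z *: v + w]/(fun t => z * v t + w t).
rewrite !convPr //; apply/funext => g.
change ((M^-1)%:C%C * (z * (a^° ** (a ** v)) g + (a^° ** (a ** w)) g) =
  z * ((M^-1)%:C%C * (a^° ** (a ** v)) g) + (M^-1)%:C%C * (a^° ** (a ** w)) g).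
by ring.
Qed.

Lemma sqop_dom b : alg b -> alg (sqop b).
Proof. by move=> fb; apply: group_algZ; apply: group_alg_conv => //; exact: group_alg_conv. Qed.

Lemma group_alg_poly_oper p : alg (poly_oper sqop p (delta 1%g)).
Proof.
apply: (poly_oper_dom sqop_lin (D := alg)); try exact: group_alg_dirac.
- by move=> z v w; exact: group_algP.
- exact: group_alg0.
- exact: sqop_dom.
Qed.

Lemma group_alg_trunc n : alg (trunc_alg n). Proof. exact: group_alg_poly_oper. Qed.

Context (H : hilbertType R) (Phi : (L -> C) -> H) (covP : covariant Phi).
Hypothesis Phi_le : forall b, alg b -> rnorm (Phi (a ** b)) ^+ 2 <= M * rnorm (Phi b) ^+ 2.

Let K := oper_cone sqop (alg : set (L -> C^o)) (Phi : (L -> C^o) -> H).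

Lemma Phi_linear (z : C) (v w : L -> C^o) : alg v -> alg w ->
  (Phi : (L -> C^o) -> H) (z *: v + w) = z *: Phi v + Phi w.
Proof. exact: cov_lin. Qed.

Lemma Phi_sqop b b' : alg b -> alg b' ->
  hdot H (Phi (sqop b)) (Phi b') = (M^-1)%:C%C * hdot H (Phi (a ** b)) (Phi (a ** b')).
Proof.
move=> fb fb'; have fab := group_alg_conv fa fb.
rewrite /sqop -[_ *: _]addr0 Phi_linear; last 2 first.
- exact: group_alg_conv.
- exact: group_alg0.
rewrite (cov0 covP) addr0 linearZl_LR /= (cov_star covP fas) // starK //.
Qed.

Lemma sqop_sym b b' : alg b -> alg b' ->
  hdot H (Phi (sqop b)) (Phi b') = hdot H (Phi b) (Phi (sqop b')).
Proof.
move=> fb fb'; rewrite Phi_sqop // [RHS]hermC expr0 mul1r /= Phi_sqop // rmorphM /=.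
by rewrite conj_Creal ?complex_real // [hdot H _ _]hermC expr0 mul1r.
Qed.

Lemma sqop_cone : poly_cone K.
Proof.
apply: oper_coneP; first exact: sqop_lin.
- by move=> z v w; exact: group_algP.
- exact: group_alg0.
- exact: sqop_dom.
- exact: Phi_linear.
- exact: sqop_sym.
Qed.

Lemma sqop_coneX : K 'X.
Proof.
move=> b fb; rewrite (poly_operX sqop_lin) Phi_sqop // hdot_rnorm mulr_ge0 //.
  by rewrite lecR invr_ge0 ltW.
by rewrite lecR sqr_ge0.
Qed.

Lemma sqop_cone_sub (s : R) :
  (forall b, alg b -> rnorm (Phi (a ** b)) ^+ 2 <= s * M * rnorm (Phi b) ^+ 2) ->
  K (s%:P - 'X).
Proof.
move=> hs b fb; rewrite poly_operB poly_operC (poly_operX sqop_lin) -scaleN1r addrC.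
have fs : alg (sqop b) by exact: sqop_dom.
have fz : alg (s%:C%C *: (b : L -> C^o)) by exact: group_algZ.
rewrite Phi_linear // -[_ *: b]addr0 Phi_linear //; last exact: group_alg0.
rewrite (cov0 covP) addr0 linearDl !linearZl_LR /= Phi_sqop // !hdot_rnorm.
rewrite mulN1r -!rmorphM -rmorphN -rmorphD /= lecR addrC subr_ge0.
rewrite mulrC ler_pdivrMr //; apply: le_trans (hs b fb) _.
by rewrite mulrAC.
Qed.

Lemma sqop_cone1X : K (1 - 'X).
Proof. by apply: (@sqop_cone_sub 1) => b fb; rewrite mul1r Phi_le. Qed.

Lemma cone_le p (s t : R) : s <= t -> K (s%:P - p) -> K (t%:P - p).
Proof.
move=> st hs; rewrite (_ : _ - _ = (t - s)%:P + (s%:P - p)); last by rewrite polyCB; ring.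
by apply: (coneD sqop_cone) => //; apply: (coneC sqop_cone); rewrite subr_ge0.
Qed.

Lemma cone_rnorm_le p (e : R) : 0 < e -> K (e%:P - p) -> K (e%:P + p) ->
  rnorm (Phi (poly_oper sqop p (delta 1%g))) <= e * rnorm (Phi (delta 1%g)).
Proof.
move=> e0 h1 h2; apply: (oper_cone_norm sqop_lin (D := alg)); try exact: ltW.
- by move=> z v w; exact: group_algP.
- exact: group_alg0.
- exact: sqop_dom.
- exact: Phi_linear.
- exact: sqop_sym.
- exact: (cone_norm sqop_cone).
- exact: group_alg_dirac.
Qed.

Lemma trunc_alg_close (e : R) m n : 0 < e -> m.+1%:R^-1 <= e ^+ 2 -> n.+1%:R^-1 <= e ^+ 2 ->
  rnorm (Phi (fun g => trunc_alg m g - trunc_alg n g)) <= e * rnorm (Phi (delta 1%g)).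
Proof.
move=> e0 hm hn.
have -> : (fun g => trunc_alg m g - trunc_alg n g) = poly_oper sqop (bernstein_trunc c m - bernstein_trunc c n) (delta 1%g).
  by rewrite poly_operB.
have hh i j : i.+1%:R^-1 <= e ^+ 2 -> j.+1%:R^-1 <= e ^+ 2 ->
    K (e%:P - (bernstein_trunc c i - bernstein_trunc c j)).
  move=> hi hj; apply: cone_le (bernstein_trunc_close sqop_cone sqop_coneX sqop_cone1X c i j e0).
  rewrite -subr_ge0; set x := i.+1%:R^-1 in hi *; set y := j.+1%:R^-1 in hj *.
  rewrite (_ : _ - _ = (2 * e ^+ 2 - x - y) / (8 * e) + e / 4); last by field; rewrite gt_eqF.
  have e0' := ltW e0; apply: addr_ge0; last exact: divr_ge0.
  by apply: divr_ge0; [lra|exact: mulr_ge0].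
apply: cone_rnorm_le => //; first exact: hh.
by rewrite -[_ - bernstein_trunc c n]opprB; exact: hh.
Qed.

Lemma trunc_alg_small (e : R) n : 0 < e -> n.+1%:R^-1 <= e ^+ 2 ->
  (forall b, alg b -> rnorm (Phi (a ** b)) ^+ 2 <= c * M * rnorm (Phi b) ^+ 2) ->
  rnorm (Phi (trunc_alg n)) <= e * rnorm (Phi (delta 1%g)).
Proof.
move=> e0 hn hc; apply: cone_rnorm_le => //.
  apply: cone_le (bernstein_trunc_small sqop_cone sqop_coneX sqop_cone1X n c0 c1 e0 (sqop_cone_sub hc)).
  rewrite -subr_ge0 invfM; set x := n.+1%:R^-1 in hn *.
  rewrite (_ : _ - _ = (e ^+ 2 - x) / (8 * e) + 3 * e / 8); last by field; rewrite gt_eqF.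
  have e0' := ltW e0; apply: addr_ge0; last by rewrite divr_ge0 ?mulr_ge0.
  by apply: divr_ge0; [lra|exact: mulr_ge0].
apply: (coneD sqop_cone); first by apply: (coneC sqop_cone); exact: ltW.
exact: (bconeW (bernstein_trunc_bcone sqop_cone sqop_coneX sqop_cone1X c n)).
Qed.

(** The truncated function dominates t - c, so that
<b_n v, v> >= <(a*a/M - c)v, v>. *)
Lemma trunc_alg_large n : M^-1 * rnorm (Phi a) ^+ 2 - c * rnorm (Phi (delta 1%g)) ^+ 2
  <= rnorm (Phi (trunc_alg n)) * rnorm (Phi (delta 1%g)).
Proof.
have fd : alg (delta 1%g) by exact: group_alg_dirac.
have fs : alg (sqop (delta 1%g)) by exact: sqop_dom.
have fp p : alg (poly_oper sqop p (delta 1%g)) by exact: group_alg_poly_oper.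
have := bernstein_trunc_ge sqop_cone sqop_coneX sqop_cone1X c n _ fd.
have -> : bernstein_trunc c n - ('X - c%:P) = bernstein_trunc c n + (c%:P - 'X) by ring.
rewrite (poly_operD sqop) poly_operB (poly_operC sqop) (poly_operX sqop_lin) -/(trunc_alg n) -scaleN1r.
set d := dirac_fun R 1%g in fd fs fp *.
have fz : alg (-1 *: sqop d) by exact: group_algZ.
have fcz : alg (c%:C%C *: (d : L -> C^o) + -1 *: sqop d) by exact: group_algP.
rewrite -[X in X + _]scale1r (Phi_linear 1 (group_alg_trunc n) fcz) scale1r.
rewrite (Phi_linear _ fd fz) -[-1 *: sqop d]addr0 (Phi_linear _ fs); last exact: group_alg0.
rewrite (cov0 covP) addr0 !linearDl !linearZl_LR /= Phi_sqop // !hdot_rnorm.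
rewrite [a ** d]conv1r //.
have := hdot_le (Phi (trunc_alg n)) (Phi d).
case: (hdot H (Phi (trunc_alg n)) (Phi d)) => x y /= h.
rewrite mulN1r -!rmorphM -rmorphN -rmorphD /= lecE /= => /andP[_].
by lra.
Qed.

End Truncation.
End Covariant.

(** * Representations of the group algebra and the regular representation *)

Section Reps.
Context (R : realType) (L : groupType).
Local Notation C := R[i].
Local Notation alg := (@group_alg R L).
Local Notation "a ** b" := (@group_conv R L a b) (at level 40, left associativity).
Local Notation "a ^°" := (@group_star R L a) (at level 1, format "a ^°").
Local Notation delta := (@dirac_fun R L).
Local Notation l2 := (l2 R L).

Lemma group_rep_covariant (H : hilbertType R) (rho : (L -> C) -> H -> H) v :
  group_rep rho -> covariant (fun b => rho b v).
Proof.
move=> hr; split=> [z b1 b2 f1 f2|a b b' fa fb fb'].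
  exact: (rep_linear hr).
by rewrite !(rep_mul hr) ?(rep_star hr) //; exact: group_alg_star.
Qed.

(** Representations may be degenerate: the unit acts as a projection. *)
Lemma group_rep_one (H : hilbertType R) (rho : (L -> C) -> H -> H) v :
  group_rep rho -> rnorm (rho (delta 1%g) v) <= rnorm v.
Proof.
move=> hr; have f1 := group_alg_dirac R (1%g : L).
have : rnorm (rho (delta 1%g) v) ^+ 2 <= rnorm v * rnorm (rho (delta 1%g) v).
  apply: le_trans (hdot_le _ _); rewrite -lecR -hdot_rnorm (rep_star hr) //.
  rewrite star_dirac invg1 -(rep_mul hr) // conv1l.
  have -> : hdot H v (rho (delta 1%g) v) = (rnorm (rho (delta 1%g) v) ^+ 2)%:C%C.
    by rewrite -hdot_rnorm (rep_star hr) // star_dirac invg1 -(rep_mul hr) // conv1l.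
  by [].
have := rnorm_ge0 v; have := rnorm_ge0 (rho (delta 1%g) v).
set x := rnorm (rho _ v); set y := rnorm v => x0 y0; rewrite expr2.
by have [->//|xn0] := eqVneq x 0; rewrite ler_pM2r // lt0r xn0.
Qed.

Lemma mulg_bij (h : L) : bijective (fun g => h^-1 * g)%g.
Proof. by exists (fun g => h * g)%g => g; rewrite ?mulKg ?mulVKg. Qed.

Lemma l2pred_conv b (xi : L -> C^o) : alg b -> xi \in @l2pred R L ->
  (b ** xi : L -> C^o) \in @l2pred R L.
Proof.
move=> + hx; elim/group_alg_ind => [|z h {}b fb IH].
  by rewrite conv0l; exact: rpred0.
have fd := group_alg_dirac R h.
rewrite convP //; apply: ((l2mass_submod R L).2 z (delta h ** xi) (b ** xi)) => //.
rewrite conv_dirac; apply/l2predP.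
exact: (psummable_reindex (mulg_bij h) (l2predP _ hx)).
Qed.

(** The default value 0 is never taken on the group algebra, by [l2pred_conv]. *)
Definition left_reg (b : L -> C) (v : l2) : l2 := insubd 0 (b ** v : L -> C^o).

Lemma left_regE b v : alg b -> left_reg b v = b ** v :> (L -> C^o).
Proof. by move=> fb; rewrite /left_reg insubdK //; apply: l2pred_conv => //; exact: l2fun_subproof. Qed.

Lemma left_reg_linear b : alg b -> linear (left_reg b).
Proof.
move=> fb z v w; apply: l2_eqP => g; rewrite l2D l2Z !left_regE //.
by have -> := convPr z v w fb.
Qed.

Lemma left_reg_lin (z : C) b1 b2 v : alg b1 -> alg b2 ->
  left_reg (fun t => z * b1 t + b2 t) v = z *: left_reg b1 v + left_reg b2 v.
Proof.
move=> f1 f2; apply: l2_eqP => g; rewrite l2D l2Z !left_regE //; last exact: group_algP.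
by rewrite convP.
Qed.

Lemma left_reg_mul b1 b2 v : alg b1 -> alg b2 -> left_reg (b1 ** b2) v = left_reg b1 (left_reg b2 v).
Proof.
move=> f1 f2; apply: l2_eqP => g; rewrite !left_regE ?convA //; exact: group_alg_conv.
Qed.

Lemma left_reg_star b v w : alg b -> l2dot (left_reg b v) w = l2dot v (left_reg b^° w).
Proof.
elim/group_alg_ind => [|z h {}b fb IH].
  rewrite star0.
  have left_reg0 u : left_reg (fun=> 0) u = 0.
    by apply: l2_eqP => g; rewrite left_regE ?conv0l //; exact: group_alg0.
  by rewrite !left_reg0 linear0l linear0r.
have fd := group_alg_dirac R h.
have fds := group_alg_star fd; have fbs := group_alg_star fb.
rewrite (left_reg_lin z v fd fb) l2dot_linearl IH starP (left_reg_lin _ w fds fbs).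
rewrite l2dot_linearr conjCK; congr (_ * _ + _).
rewrite star_dirac; symmetry; apply: (l2dot_reindex (mulg_bij h^-1%g)) => i.
  by rewrite left_regE // conv_dirac invgK mulKg.
by rewrite left_regE ?conv_dirac //; exact: group_alg_dirac.
Qed.

Lemma left_reg1 v : left_reg (delta 1%g) v = v.
Proof. by apply: l2_eqP => g; rewrite left_regE ?conv1l //; exact: group_alg_dirac. Qed.

Lemma left_reg_covariant (v : l2) : covariant (H := l2_space R L) (fun b => left_reg b v).
Proof.
split=> [z b1 b2 f1 f2|a b b' fa fb fb']; first exact: left_reg_lin.
have fs := group_alg_star fa; rewrite (left_reg_mul v fa fb) (left_reg_mul v fs fb').
exact: left_reg_star.
Qed.

Lemma bounded_linear_continuous_rnorm (V W : normedModType C) (f : V -> W) (N : R) :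
  linear f -> 0 <= N -> (forall v, rnorm (f v) <= N * rnorm v) -> continuous f.
Proof.
move=> lf N0 hN v; apply/cvgrPdist_lt => e' e'0.
have [e e0 ->] : exists2 e : R, 0 < e & e' = e%:C%C.
  exists (complex.Re e'); last by rewrite RRe_real // gtr0_real.
  by rewrite -ltcR RRe_real // gtr0_real.
have d0 : (0 : C) < (e / (N + 1))%:C%C by rewrite ltcR divr_gt0 // ltr_wpDl.
near=> w; have hw : `|v - w| < (e / (N + 1))%:C%C.
  by near: w; apply/nbhs_normP; exists (e / (N + 1))%:C%C.
have -> : f v - f w = f (v - w).
  by rewrite -scaleN1r addrC -lf scaleN1r addrC.
rewrite rnormE ltcR in hw; rewrite rnormE ltcR.
apply: le_lt_trans (hN _) _.
rewrite ltr_pdivlMr in hw; last by rewrite ltr_wpDl.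
by have := rnorm_ge0 (v - w); lra.
Unshelve. all: by end_near. Qed.

(** Boundedness comes for free from [cov_bound], applied to the orbit of a vector. *)
Lemma left_reg_continuous b : alg b -> continuous (left_reg b).
Proof.
move=> fb; have [N [N0 hN]] := cov_bound fb.
apply: (bounded_linear_continuous_rnorm (left_reg_linear fb) N0) => v.
have le := hN _ _ (left_reg_covariant v) _ (group_alg_dirac R (1%g : L)).
by rewrite (conv1r fb) (left_reg1 v) in le.
Qed.

Lemma left_reg_group_rep : group_rep (H := l2_space R L) left_reg.
Proof.
split.
- exact: left_reg_linear.
- exact: left_reg_continuous.
- exact: left_reg_lin.
- by move=> b1 b2 v f1 f2; exact: left_reg_mul.
- by move=> b v w fb; exact: left_reg_star.
Qed.

Lemma l2norm_l2n (v : l2) : l2norm [set: L] v = (l2n v)%:E.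
Proof. by rewrite /l2norm /l2n; have -> := esum_psum (l2P v). Qed.

Lemma opnorm_left_reg a : alg a ->
  opnorm [set: l2_space R L] (@hnorm R (l2_space R L)) (left_reg a) = group_reduced_norm a.
Proof.
move=> fa; congr ereal_sup; apply/seteqP; split=> [_ [v [_ v1] <-]|_ [xi [xf x1] <-]].
  exists v; first by split; [exact: l2fun_subproof|rewrite l2norm_l2n].
  by rewrite -left_regE // l2norm_l2n.
exists (L2 (xf : xi \in @l2pred R L)); first by split=> //; rewrite /hnorm l2_rnormE -l2norm_l2n.
by rewrite /hnorm l2_rnormE -l2norm_l2n left_regE.
Qed.

End Reps.

(** * Inducing the regular representation *)

Section FreeAction.
Context (R : realType) (T : choiceType) (L : groupType) (D : set T) (op : T -> L -> T) (t0 : T).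
Hypothesis opD : forall t s, D t -> D (op t s).
Hypothesis op1 : forall t, D t -> op t 1%g = t.
Hypothesis opM : forall t s1 s2, D t -> op t (s1 * s2)%g = op (op t s1) s2.
Hypothesis op_free : forall t s1 s2, D t -> op t s1 = op t s2 -> s1 = s2.

Definition aorbit t : set T := [set op t s | s in [set: L]].

Lemma aorbit_refl t : D t -> aorbit t t.
Proof. by move=> Dt; exists 1%g => //; rewrite op1. Qed.

Lemma aorbit_op t s : D t -> aorbit (op t s) = aorbit t.
Proof.
move=> Dt; apply/seteqP; split=> [_ [s' _ <-]|_ [s' _ <-]].
  by exists (s * s')%g => //; rewrite opM.
by exists (s^-1 * s')%g => //; rewrite -opM // mulVKg.
Qed.

Lemma aorbit_xget t : D t -> exists s, xget t0 (aorbit t) = op t s.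
Proof.
by move=> Dt; case: (xgetI t0 (aorbit_refl Dt)) => s _ <-; exists s.
Qed.

(** Each orbit of a free action is parametrized by the group, once a point of it is
chosen. *)
Lemma esum_orbits (F : T -> \bar R) : (forall t, 0 <= F t)%E ->
  (\esum_(t in D) F t =
   \esum_(c in aorbit @` D) \esum_(s in [set: L]) F (op (xget t0 c) s))%E.
Proof.
move=> F0; rewrite esum_esum //.
apply: (reindex_esum _ _ (fun k => op (xget t0 k.1) k.2)); split.
- move=> [c s] /= [[t Dt <-] _]; have [s' ->] := aorbit_xget Dt.
  by do 2!apply: opD.
- move=> [c1 s1] [c2 s2] /set_mem[/= [t1 D1 <-] _] /set_mem[/= [t2 D2 <-] _] /= E.
  have [s1' e1] := aorbit_xget D1; have [s2' e2] := aorbit_xget D2.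
  have eqo : aorbit t1 = aorbit t2.
    have := congr1 aorbit E; rewrite e1 e2 !aorbit_op //; exact: opD.
  move: E; rewrite -eqo e1 => /op_free -> //; exact: opD.
- move=> t Dt; have [s hs] := aorbit_xget Dt.
  exists (aorbit t, s^-1)%g => /=; first by split=> //; exists t.
  by rewrite hs -opM // mulgV op1.
Qed.

End FreeAction.

(** A finitely supported sum is 0 by convention when its support is infinite.
Restricting it to the support of [f], which is finite on fibres for [f] of compact
support, makes it an honest sum. *)
Lemma fsum_supp (R : realType) (T : choiceType) (V : nmodType) (A : set T) (f : T -> R[i]) (F : T -> V) :
  (forall t, f t = 0 -> F t = 0) ->
  \sum_(t \in A) F t = \sum_(t \in [set t | A t /\ f t != 0]) F t.
Proof.
move=> fF; symmetry; apply: fsbig_widen => [t []//|t [/= At nt]].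
by apply: fF; apply/eqP/negPn/negP => ft; apply: nt.
Qed.

Section RegularRep.
Context (R : realType) (G : etale_groupoid).
Local Notation C := R[i].
Implicit Types (f : arr G -> C) (x y : obj G) (g h k : arr G).

Lemma gmul_ginvK g h : src g = src h -> gmul (gmul g (ginv h)) h = g.
Proof.
move=> gh; rewrite -gmulA ?src_ginv ?tgt_ginv //.
by rewrite gmulVl -gh gmul_idr.
Qed.

Lemma gmul_ginvKV g h : src g = tgt h -> gmul (gmul g h) (ginv h) = g.
Proof.
move=> gh; rewrite -gmulA ?src_ginv ?tgt_ginv //.
by rewrite gmulVr -gh gmul_idr.
Qed.

Lemma ginv_gmulK g h : tgt g = tgt h -> gmul g (gmul (ginv g) h) = h.
Proof.
move=> gh; rewrite gmulA ?src_ginv ?tgt_ginv //.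
by rewrite gmulVr gh gmul_idl.
Qed.

Lemma regular_diracE f g k : src g = src k -> regular_dirac f g k = f (gmul k (ginv g)).
Proof.
move=> gk; rewrite /regular_dirac -(fsbig_widen [set gmul k (ginv g)]).
- by rewrite fsbig_set1 gmul_ginvK // /dirac_fun eqxx mulr1.
- by move=> _ ->; rewrite /src_fiber /= src_gmul ?src_ginv // tgt_ginv.
- move=> h [/= hg hne]; rewrite /dirac_fun; case: eqP => [kE|_]; last by rewrite mulr0.
  by case: hne; rewrite kE gmul_ginvKV.
Qed.

Lemma regular_opE y f (xi : arr G -> C) k : src k = y ->
  regular_op y f xi k = \sum_(g \in src_fiber y) xi g * f (gmul k (ginv g)).
Proof.
by move=> ky; apply: eq_fsbigr => g /set_mem gy; rewrite regular_diracE // gy ky.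
Qed.

Lemma ginv_gmulVK g h : src g = tgt h -> gmul (ginv g) (gmul g h) = h.
Proof.
move=> gh; rewrite gmulA ?src_ginv ?tgt_ginv //.
by rewrite gmulVl gh gmul_idl.
Qed.

Lemma gmul_ginv_ginv g k : tgt g = tgt k -> gmul k (ginv (gmul (ginv g) k)) = g.
Proof.
move=> gk; rewrite -{1}(ginv_gmulK gk) gmul_ginvKV //.
by rewrite tgt_gmul ?src_ginv // tgt_ginv.
Qed.

Lemma division_bij k : set_bij [set h | tgt h = tgt k] (src_fiber (src k))
  (fun h => gmul (ginv h) k).
Proof.
split=> [h /= hk|h h' /set_mem /= hk /set_mem /= hk' E|g /= gk].
- by rewrite /src_fiber /= src_gmul // src_ginv.
- by rewrite -(gmul_ginv_ginv hk) -(gmul_ginv_ginv hk') E.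
have sg : src k = tgt (ginv g) by rewrite tgt_ginv.
exists (gmul k (ginv g)); first by rewrite /= tgt_gmul.
rewrite -[in X in gmul _ X](gmul_ginvK (esym gk)).
by rewrite ginv_gmulVK // src_gmul // src_ginv.
Qed.

(** On the fibre, the regular representation is given by the same convolution
formula as induced representations. *)
Lemma regular_op_sum y f (xi : arr G -> C) k : src k = y ->
  regular_op y f xi k = \sum_(h \in [set h | tgt h = tgt k]) f h * xi (gmul (ginv h) k).
Proof.
move=> ky; rewrite regular_opE // -ky.
rewrite (reindex_fsbig _ _ _ _ (division_bij k)).
by apply: eq_fsbigr => h /set_mem /= hk; rewrite gmul_ginv_ginv // mulrC.
Qed.

End RegularRep.

Section InducedRegular.
Context (R : realType) (G : etale_groupoid) (x : obj G).
Local Notation C := R[i].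
Local Notation Iso := (@isotropy G x).
Local Notation l2 := (l2 R Iso).
Local Notation left_reg := (@left_reg R Iso).
Local Notation H := (l2_space R Iso).
Implicit Types (xi : arr G -> H).

Definition equivariant xi := forall g (h : Iso), src_fiber x g ->
  xi (gmul g (\val h)) = left_reg (group_star (dirac_fun R h)) (xi g).

(** An equivariant function with values in l^2(L) is determined by this scalar
function: by [equivariantE], xi(g)(h) = xi(gh)(1). *)
Definition at_one xi : arr G -> C := fun g => (xi g : l2) 1%g.

Lemma iso_comp g (h : Iso) : src_fiber x g -> src g = tgt (\val h).
Proof. by move=> gx; rewrite (isotropyP h).2. Qed.

Lemma equivariantE xi g (h : Iso) : equivariant xi -> src_fiber x g ->
  at_one xi (gmul g (\val h)) = (xi g : l2) h.
Proof.
move=> he gx; rewrite /at_one he // star_dirac left_regE; last exact: group_alg_dirac.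
by rewrite conv_dirac invgK mulg1.
Qed.

Lemma rnorm_l2_esum (v : H) :
  ((rnorm v ^+ 2)%:E = \esum_(h in [set: Iso]) (rnorm ((v : l2) h : C^o) ^+ 2)%:E)%E.
Proof. by rewrite l2_rnormE l2n_sqr -esum_psum //; exact: l2P. Qed.

(** The fibre over [x] is a free right [L]-space whose orbits are the left cosets,
and summing |xi(g)(h)|^2 over h in [L] sums over the coset of g. *)
Lemma ind_norm_at_one xi : equivariant xi ->
  ind_norm x xi = l2norm (src_fiber x) (at_one xi : arr G -> C^o).
Proof.
move=> he; congr sqrte.
pose op (g : arr G) (s : Iso) := gmul g (\val s).
have opD g s : src_fiber x g -> src_fiber x (op g s).
  by move=> gx; rewrite /src_fiber /= src_gmul ?(isotropyP s).1 //; exact: iso_comp.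
have op1 g : src_fiber x g -> op g 1%g = g.
  by move=> gx; rewrite /op /= -{2}[g]gmul_idr gx.
rewrite (@esum_orbits _ _ _ (src_fiber x) op (idm x)) //; first last.
- by move=> g; rewrite lee_fin sqr_ge0.
- move=> g s1 s2 gx E; apply/val_inj; have /(congr1 (gmul (ginv g))) := E.
  by rewrite !ginv_gmulVK //; exact: iso_comp.
- by move=> g s1 s2 gx; rewrite /op /= gmulA //; [exact: iso_comp|exact: isotropy_mul_comp].
apply: eq_esum => c [g gx <-].
rewrite -/(aorbit op g) /coset_repr; have [s ->] := @aorbit_xget _ _ (src_fiber x) op (idm x) op1 g gx.
rewrite rnorm_l2_esum; apply: eq_esum => h _.
by rewrite equivariantE //; exact: opD.
Qed.

Lemma ind_op_at_one (f : arr G -> C) xi g :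
  finite_set [set h | tgt h = tgt g /\ f h != 0] -> src_fiber x g ->
  at_one (ind_op f xi) g = regular_op x f (at_one xi) g.
Proof.
move=> fin gx; rewrite regular_op_sum // /at_one /ind_op.
pose S := [set h | tgt h = tgt g /\ f h != 0].
rewrite (@fsum_supp _ _ _ _ f) => [|h ->]; last by rewrite scale0r.
rewrite [RHS](@fsum_supp _ _ _ _ f) => [|h ->]; last by rewrite mul0r.
rewrite !fsbig_finite //=.
by rewrite (big_morph (fun v : l2 => v 1%g) (id1 := 0) (op1 := +%R)).
Qed.

Lemma ind_op_equivariant (f : arr G -> C) xi : (forall z : obj G, finite_set [set h | tgt h = z /\ f h != 0]) ->
  equivariant xi -> equivariant (ind_op f xi).
Proof.
move=> fin he g s gx; have cs := iso_comp s gx.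
pose S := [set h | tgt h = tgt g /\ f h != 0].
rewrite /ind_op tgt_gmul // !(@fsum_supp _ _ _ [set h | tgt h = tgt g] f); first last.
- by move=> h ->; rewrite scale0r.
- by move=> h ->; rewrite scale0r.
have fS : finite_set S by exact: fin.
have fd : group_alg (group_star (dirac_fun R s)) by exact/group_alg_star/group_alg_dirac.
have ll := left_reg_linear fd.
rewrite !fsbig_finite // (big_morph _ (linear_mapD ll) (linear_map0 ll)).
rewrite [LHS]big_seq [RHS]big_seq; apply: eq_bigr => h; rewrite in_fset_set // => /set_mem[hg _].
rewrite (linear_mapZ ll) -he; last by rewrite /src_fiber /= src_gmul // src_ginv.
by rewrite gmulA // ?src_ginv.
Qed.

Lemma ind_opnorm_left_reg_le (f : arr G -> C) :
  (forall z : obj G, finite_set [set h | tgt h = z /\ f h != 0]) ->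
  (ind_opnorm (x := x) (H := H) left_reg f <= reduced_norm f)%E.
Proof.
move=> fin; have le2 : (opnorm (l2_fiber x) (fun eta => l2norm (src_fiber x) (eta : arr G -> C^o))
    (regular_op x f) <= reduced_norm f)%E.
  by apply: ereal_sup_ubound; exists x.
apply: le_trans le2.
apply: ereal_sup_le => _ [xi [[xi0 he xifin] xi1] <-].
have he' : equivariant xi by exact: he.
exists (at_one xi); first split.
- split; last by rewrite -ind_norm_at_one.
  by move=> g gx; rewrite /at_one xi0.
- by rewrite -ind_norm_at_one.
rewrite ind_norm_at_one; last exact: ind_op_equivariant.
by congr sqrte; apply: eq_esum => g gx; rewrite ind_op_at_one.
Qed.

End InducedRegular.

(** * Elementary tensors and their reduced norm *)

Section Tensor.
Context (R : realType) (Gam : groupType) (X : topologicalType)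
  (hX : hausdorff_space X) (lcX : locally_compact [set: X])
  (a : homeo_action Gam X) (x : X).
Local Notation C := R[i].
Local Notation G := (transformation_groupoid a hX lcX).
Local Notation Iso := (@isotropy G x).

Definition iso_gam (s : Iso) : Gam := (\val s).1.

Lemma iso_val (s : Iso) : \val s = (iso_gam s, x).
Proof. by have [ss _] := isotropyP s; rewrite [LHS]surjective_pairing; congr pair; exact: ss. Qed.

Lemma iso_gamx (s : Iso) : a (iso_gam s) x = x.
Proof. by have [_] := isotropyP s; rewrite iso_val. Qed.

Lemma iso_gam_inj : injective iso_gam.
Proof. by move=> s t st; apply/val_inj; rewrite !iso_val st. Qed.

Lemma iso_gamM s t : iso_gam (s * t)%g = (iso_gam s * iso_gam t)%g.
Proof. by []. Qed.

Lemma iso_gam1 : iso_gam 1%g = 1%g.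
Proof. by []. Qed.

Lemma iso_gamV s : iso_gam s^-1%g = (iso_gam s)^-1%g.
Proof. by []. Qed.

Definition mk_iso g (gx : a g x = x) : Iso := @isotropy_of G x (g, x) erefl gx.

Definition extend (b : Iso -> C) (g : Gam) : C :=
  if pselect (a g x = x) is left gx then b (mk_iso gx) else 0.

Lemma extend_iso b s : extend b (iso_gam s) = b s.
Proof.
rewrite /extend; case: pselect => [gx|]; last by case; exact: iso_gamx.
by congr b; exact: iso_gam_inj.
Qed.

Lemma extend_supp b g : extend b g != 0 -> exists s, g = iso_gam s.
Proof.
rewrite /extend; case: pselect => [gx _|]; last by rewrite eqxx.
by exists (mk_iso gx).
Qed.

Definition group_tensor (b : Iso -> C) (u : X -> C) : arr G -> C :=
  fun p => extend b p.1 * u p.2.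

(** Convolutions by elementary tensors become sums over the stabilizer, that is,
values of [group_sum], to which linearity in [b] applies. *)
Lemma extend_sum (V : lmodType C) b (F : arr G -> V) (z : X) :
  \sum_(h \in [set h : arr G | tgt h = z]) extend b h.1 *: F h =
  group_sum b (fun s => F (iso_gam s, a (iso_gam s)^-1%g z)).
Proof.
pose e (s : Iso) : arr G := (iso_gam s, a (iso_gam s)^-1%g z).
have ei : injective e by move=> s t [] /iso_gam_inj.
rewrite -(fsbig_widen (e @` [set: Iso])); first last.
- move=> [g w] [/= gw ng]; have [->|g0] := eqVneq (extend b g) 0; first by rewrite scale0r.
  have [s gs] := extend_supp g0; case: ng; exists s => //; rewrite /e -gs -gw.
  by congr pair; exact: actK.
- by move=> _ [s _ <-] /=; rewrite /ttgt /= -actM mulgV act1.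
rewrite (reindex_fsbig e [set: Iso]); last by apply: inj_bij; move=> s t _ _; exact: ei.
by apply: eq_fsbigr => s _; rewrite extend_iso.
Qed.

Lemma regular_op_tensor b (u : X -> C) (y : X) (xi : arr G -> C) (k : Gam) :
  regular_op (y : obj G) (group_tensor b u) xi (k, y) =
  group_sum b (fun s => (u (a ((iso_gam s)^-1 * k)%g y) * xi ((iso_gam s)^-1 * k, y)%g) : C^o).
Proof.
rewrite regular_op_sum //.
rewrite (eq_fsbigr (fun h : arr G => (extend b h.1 : C) *: ((u h.2 * xi (gmul (ginv h) (k, y))) : C^o))).
  by rewrite extend_sum; apply: eq_fsbigr => s _ /=; rewrite -actM.
by move=> h _; rewrite /group_tensor -mulrA.
Qed.

Lemma esum_src_fiber (F : arr G -> \bar R) (y : X) :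
  (\esum_(g in src_fiber (y : obj G)) F g = \esum_(k in [set: Gam]) F (k, y))%E.
Proof.
apply: (reindex_esum _ _ (fun k : Gam => (k, y) : arr G)); split => //.
- by move=> k1 k2 _ _ [].
- by move=> [k z] /= <-; exists k.
Qed.

(** Identify the fibre over [y] with the acting group, and put eta(k) = u(ky)xi(k).
Then (b (x) u)xi at k is the sum of b(s) eta(s^-1 k) over s in the stabilizer, so
that each right coset of the stabilizer carries a copy of the regular
representation applied to the restriction of eta. *)
Lemma reduced_norm_tensor b (u : X -> C) (q : R) : group_alg b -> 0 <= q ->
  (forall z, rnorm (u z : C^o) <= 1) ->
  (forall v : l2 R Iso, l2n (left_reg b v) <= q * l2n v) ->
  (reduced_norm (group_tensor b u) <= q%:E)%E.
Proof.
move=> fb q0 u1 hb; apply: ge_ereal_sup => _ [y _ <-].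
apply: ge_ereal_sup => _ [xi [[xi0 xifin] xi1] <-].
pose eta (k : Gam) : C^o := u (a k y) * xi (k, y).
pose op (k : Gam) (s : Iso) : Gam := ((iso_gam s)^-1 * k)%g.
have opM t s1 s2 : [set: Gam] t -> op t (s1 * s2)%g = op (op t s1) s2.
  by move=> _; rewrite /op iso_gamM invgM mulgA.
have op1 t : [set: Gam] t -> op t 1%g = t by move=> _; rewrite /op iso_gam1 invg1 mul1g.
have op_free t s1 s2 : [set: Gam] t -> op t s1 = op t s2 -> s1 = s2.
  by move=> _ /mulIg/invg_inj/iso_gam_inj.
have orb F := @esum_orbits R Gam Iso [set: Gam] op 1%g (fun _ _ _ => I) op1 opM op_free F.
have etafin : (\esum_(k in [set: Gam]) (rnorm (eta k) ^+ 2)%:E <= 1)%E.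
  have : (\esum_(g in src_fiber (y : obj G)) (rnorm (xi g : C^o) ^+ 2)%:E <= 1)%E.
    move: xi1; rewrite /l2norm -[X in (_ <= X)%E -> _](_ : sqrte 1 = 1%E).
      by rewrite lee_sqrt.
    by rewrite /= sqrtr1.
  apply: le_trans; rewrite esum_src_fiber; apply: le_esum => k _.
  rewrite lee_fin ler_pXn2r ?nnegrE ?rnorm_ge0 // /eta rnormM.
  by rewrite ler_piMl ?rnorm_ge0.
have etage0 k : (0 <= (rnorm (eta k) ^+ 2)%:E)%E by rewrite lee_fin sqr_ge0.
rewrite /l2norm -[X in (_ <= X)%E](_ : sqrte (q ^+ 2)%:E = q%:E); last first.
  by rewrite /= sqrtr_sqr ger0_norm.
rewrite lee_sqrt ?lee_fin ?sqr_ge0 // esum_src_fiber.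
apply: (@le_trans _ _ ((q ^+ 2)%:E * \esum_(k in [set: Gam]) (rnorm (eta k) ^+ 2)%:E)%E); last first.
  by rewrite -[X in (_ <= X)%E]mule1 lee_wpmul2l // lee_fin sqr_ge0.
rewrite orb; last by move=> k; rewrite lee_fin sqr_ge0.
rewrite orb // in etafin *.
rewrite -esumZ ?sqr_ge0 //; last by move=> c; apply: esum_ge0.
apply: le_esum => c hc; set r := xget 1%g c.
(* The restriction of eta to the coset of [r]; the inversion below converts the
   parametrization of the orbit by s^-1 r into one by t r. *)
pose v (t : Iso) : C^o := eta (iso_gam t * r)%g.
have invb : bijective (fun t : Iso => t^-1%g) by exists (fun t => t^-1%g) => t; rewrite invgK.
have vE : (\esum_(s in [set: Iso]) (rnorm (eta (op r s)) ^+ 2)%:E =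
    \esum_(s in [set: Iso]) (l2mass v s)%:E)%E.
  symmetry; apply: (reindex_esum _ _ (fun t : Iso => t^-1%g)).
  by rewrite setTT_bijective.
have vl2 : v \in @l2pred R Iso.
  apply/l2predP; split=> [t|]; first exact: sqr_ge0.
  rewrite -vE; apply: le_lt_trans (ltry 1); apply: le_trans etafin.
  apply: esum_ge; exists [set c]; first by split=> // _ ->.
  by rewrite fsbig_set1.
have -> : (\esum_(s in [set: Iso]) (rnorm (regular_op (y : obj G) (group_tensor b u) xi (op r s, y) : C^o) ^+ 2)%:E =
  \esum_(s in [set: Iso]) (l2mass (left_reg b (L2 vl2)) s)%:E)%E.
  symmetry; rewrite (reindex_esum [set: Iso] _ (fun t : Iso => t^-1%g)); last first.
    by rewrite setTT_bijective.
  apply: eq_esum => s _; rewrite /l2mass left_regE // group_convE regular_op_tensor.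
  congr (rnorm _ ^+ 2)%:E; congr group_sum; apply/funext => t; by rewrite /= /v /eta /op !mulgA.
rewrite vE (esum_psum (l2P (left_reg b (L2 vl2)))) (esum_psum (l2P (L2 vl2))) -EFinM lee_fin.
rewrite -!l2n_sqr -exprMn ler_pXn2r ?nnegrE ?l2n_ge0 ?mulr_ge0 ?l2n_ge0 //.
Qed.

End Tensor.

(** * A lower bound for induced representations *)

Section IndLower.
Context (R : realType) (Gam : groupType) (X : topologicalType)
  (hX : hausdorff_space X) (lcX : locally_compact [set: X])
  (a : homeo_action Gam X) (x : X).
Local Notation C := R[i].
Local Notation G := (transformation_groupoid a hX lcX).
Local Notation Iso := (@isotropy G x).
Local Notation delta := (@dirac_fun R Iso).
Context (H : hilbertType R) (rho : (Iso -> C) -> H -> H) (hr : group_rep rho).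

Lemma group_sum_rep b k v : group_alg b ->
  group_sum b (fun s => rho (delta (k * s)%g) v) = rho (group_conv (delta k) b) v.
Proof.
have cov := group_rep_covariant v hr.
elim/group_alg_ind => [|z s {}b fb IH].
  by rewrite group_sum0 conv0r ?(cov0 cov) //; exact: group_alg_dirac.
have fd := group_alg_dirac R s; have fk := group_alg_dirac R k.
rewrite group_sumP // group_sum_dirac IH convPr // (rep_linear hr); try exact: group_alg_conv.
by rewrite [group_conv _ (delta s)]conv_dirac dirac_shift.
Qed.

Variable v : H.

(** The equivariant function supported on the isotropy group with value rho(1)v at
the unit; rho(1) appears because equivariance forces the values into its range. *)
Definition ind_vec (p : arr G) : H :=
  if pselect (src p = x /\ tgt p = x) is left e then rho (delta (isotropy_of e.1 e.2)^-1%g) v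
  else 0.

Lemma ind_vec_iso (s : Iso) : ind_vec (\val s) = rho (delta s^-1%g) v.
Proof.
rewrite /ind_vec; case: pselect => [e|[]]; last exact: isotropyP.
by congr (rho (delta _^-1%g) v); exact/val_inj.
Qed.

Lemma ind_vec_supp p : ind_vec p = 0 \/ exists s : Iso, p = \val s.
Proof.
rewrite /ind_vec; case: pselect => [e|_]; [right|by left].
by exists (isotropy_of e.1 e.2).
Qed.

Lemma ind_vec_equiv g (h : Iso) : src_fiber (x : obj G) g ->
  ind_vec (gmul g (\val h)) = rho (group_star (delta h)) (ind_vec g).
Proof.
move=> gx; have fh := group_alg_dirac R h.
have fs : group_alg (group_star (delta h)) by exact: group_alg_star.
have [|nx] := pselect (exists s : Iso, g = \val s).
  move=> [s ->]; rewrite -[gmul _ _]/(\val (s * h)%g) !ind_vec_iso.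
  rewrite -(rep_mul hr) //; last exact: group_alg_dirac.
  by rewrite star_dirac conv_dirac dirac_shift invgM.
have [->|[s gs]] := ind_vec_supp g; last by case: nx; exists s.
rewrite (linear_map0 (rep_op_linear hr fs)).
have [//|[s gs]] := ind_vec_supp (gmul g (\val h)).
case: nx; exists (s * h^-1)%g; rewrite -[RHS]/(gmul (\val s) (ginv (\val h))) -gs.
by rewrite gmul_ginvKV // gx (isotropyP h).2.
Qed.

Let c0 := left_coset (x : obj G) (idm (x : obj G) : arr G).

Lemma coset_repr_unit : exists s : Iso, coset_repr (x : obj G) c0 = \val s.
Proof.
have : c0 (idm (x : obj G)) by exists 1%g => //; rewrite /= /tmul /= mulg1.
move=> /(xgetI (idm (x : obj G)))[s _ sE]; exists s.
by rewrite /coset_repr -sE /= /tmul /= mul1g [RHS]surjective_pairing.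
Qed.

Lemma ind_vec_coset c : left_cosets (x : obj G) c -> ind_vec (coset_repr (x : obj G) c) != 0 -> c = c0.
Proof.
move=> [g gx <-] nz.
have [s gs] : exists s : Iso, g = \val s.
  have [z0|[s sE]] := ind_vec_supp (coset_repr (x : obj G) (left_coset (x : obj G) g)).
    by rewrite z0 eqxx in nz.
  have : left_coset (x : obj G) g g by exists 1%g => //; rewrite /= -[in RHS](gmul_idr g) gx.
  move=> /(xgetI (idm (x : obj G)))[h _ hE]; exists (s * h^-1)%g.
  rewrite -[RHS]/(gmul (\val s) (ginv (\val h))) -sE /coset_repr -hE gmul_ginvKV //.
  by rewrite gx (isotropyP h).2.
rewrite gs; apply/seteqP; split=> [_ [h _ <-]|_ [h _ <-]].
  by exists (s * h)%g => //; rewrite /= /tmul /= mul1g.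
exists (s^-1 * h)%g => //; rewrite -[LHS]/(gmul (\val s) (gmul (ginv (\val s)) (\val h))).
by rewrite ginv_gmulK ?(isotropyP s).2 ?(isotropyP h).2 // -[LHS]gmul_idl (isotropyP h).2.
Qed.

Lemma coset_unit : left_cosets (x : obj G) c0.
Proof. by exists (idm (x : obj G)) => //; exact: src_idm. Qed.

Lemma rnorm_rep_dirac k b : group_alg b ->
  rnorm (rho (group_conv (delta k) b) v) = rnorm (rho b v).
Proof. by move=> fb; rewrite (cov_dirac k (group_rep_covariant v hr)). Qed.

Lemma rnorm_ind_vec (s : Iso) : rnorm (ind_vec (\val s)) = rnorm (rho (delta 1%g) v).
Proof.
have f1 := group_alg_dirac R (1%g : Iso).
by rewrite ind_vec_iso -[RHS](rnorm_rep_dirac s^-1%g f1) conv_dirac dirac_shift mulg1.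
Qed.

Hypothesis v1 : rnorm v <= 1.

Lemma ind_norm_vec : (@ind_norm R G x H ind_vec <= 1)%E.
Proof.
rewrite /ind_norm /l2norm -[X in (_ <= X)%E](_ : sqrte 1 = 1%E); last by rewrite /= sqrtr1.
rewrite lee_sqrt // (esumID [set c0]); last by move=> c _; rewrite lee_fin sqr_ge0.
rewrite [X in (_ + X)%E]esum1 ?adde0; last first.
  move=> c [hc nc]; have [->|/(ind_vec_coset hc)//] := eqVneq (ind_vec (coset_repr (x : obj G) c)) 0.
  by rewrite rnorm0 expr0n.
rewrite setIidr; last by move=> _ ->; exact: coset_unit.
rewrite esum_set1 ?lee_fin ?sqr_ge0 //; have [s ->] := coset_repr_unit.
rewrite rnorm_ind_vec exprn_ile1 ?rnorm_ge0 //.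
by rewrite (le_trans (group_rep_one v hr)).
Qed.

Lemma ind_op_vec b (u : X -> C) (s : Iso) : group_alg b -> u x = 1 ->
  rnorm (ind_op (group_tensor b u) ind_vec (\val s)) = rnorm (rho b v).
Proof.
move=> fb ux; rewrite -(rnorm_rep_dirac s^-1%g) // -group_sum_rep //; congr rnorm.
rewrite /ind_op (isotropyP s).2.
rewrite (eq_fsbigr (fun h : arr G => (extend b h.1 : C) *: (u h.2 *: ind_vec (gmul (ginv h) (\val s))))).
  rewrite extend_sum; congr group_sum; apply/funext => t.
  rewrite -iso_gamV iso_gamx ux scale1r.
  by rewrite -iso_val -[gmul _ _]/(\val (t^-1 * s)%g) ind_vec_iso invgM invgK.
by move=> h _; rewrite /group_tensor scalerA.
Qed.

(** Apply the operator to the equivariant function supported on the trivial coset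
with value rho(1)v at the unit. There the convolution only meets the values of [u] at
[x], and the result at the unit is rho(b)v. *)
Lemma ind_opnorm_tensor_ge b (u : X -> C) : group_alg b -> u x = 1 ->
  ((rnorm (rho b v))%:E <= @ind_opnorm R G x H rho (group_tensor b u))%E.
Proof.
move=> fb ux; apply: (@le_trans _ _ (@ind_norm R G x H (ind_op (group_tensor b u) ind_vec))).
  rewrite /ind_norm /l2norm -[X in (X <= _)%E](_ : sqrte (rnorm (rho b v) ^+ 2)%:E = _); last first.
    by rewrite /= sqrtr_sqr ger0_norm ?rnorm_ge0.
  rewrite lee_sqrt; last by apply: esum_ge0 => c _; rewrite lee_fin sqr_ge0.
  apply: esum_ge; exists [set c0].
    by split; [exact: finite_set1|move=> _ ->; exact: coset_unit].
  by rewrite fsbig_set1; have [s ->] := coset_repr_unit; rewrite ind_op_vec.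
apply: ereal_sup_ubound; exists ind_vec => //; split; last exact: ind_norm_vec.
split; last exact: le_lt_trans ind_norm_vec (ltry 1).
- move=> g ng; have [//|[s gs]] := ind_vec_supp g; case: ng.
  by rewrite gs; exact: (isotropyP s).1.
- by move=> g h gx; exact: ind_vec_equiv.
Qed.

End IndLower.

(** * Elementary tensors in representations of the groupoid *)

Lemma isometry_continuous (K : numFieldType) (V W : normedModType K) (f : V -> W) :
  (forall v w, `|f v - f w| = `|v - w|) -> continuous f.
Proof.
move=> hf v; apply/cvgrPdist_lt => e e0; near=> w.
by rewrite hf; near: w; apply/nbhs_normP; exists e.
Unshelve. all: by end_near. Qed.

Lemma conj_continuous (R : realType) : continuous (fun z : R[i]^o => z^* : R[i]^o).
Proof. by apply: isometry_continuous => v w; rewrite -rmorphB norm_conjC. Qed.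

Section CcTensor.
Context (R : realType) (Gam : groupType) (X : topologicalType)
  (hX : hausdorff_space X) (lcX : locally_compact [set: X])
  (a : homeo_action Gam X) (x : X).
Local Notation C := R[i].
Local Notation G := (transformation_groupoid a hX lcX).
Local Notation Iso := (@isotropy G x).
Local Notation alg := (@group_alg R Iso).
Local Notation "b ** c" := (@group_conv R Iso b c) (at level 40, left associativity).
Local Notation "b ^°" := (@group_star R Iso b) (at level 1, format "b ^°").
Local Notation delta := (@dirac_fun R Iso).

Definition Cc_obj : set (X -> C) :=
  [set u | continuous (u : X -> C^o) /\ compact (closure [set z | u z != 0])].

Lemma compact_support_sub (T : topologicalType) (A B : set T) :
  hausdorff_space T -> compact B -> A `<=` B -> compact (closure A).
Proof.
move=> hT cB AB; apply: (subclosed_compact (@closed_closure _ A) cB).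
have clB : closed B by exact: compact_closed.
by have := closureS AB; rewrite -((closure_id B).1 clB).
Qed.

Lemma Cc_objM u1 u2 : Cc_obj u1 -> Cc_obj u2 -> Cc_obj (fun z => u1 z * u2 z).
Proof.
move=> [c1 k1] [c2 k2]; split; first by move=> z; exact: (cvgM (c1 z) (c2 z)).
apply: compact_support_sub k1 _ => // z /= nz; apply: subset_closure => /=.
by apply: contraNneq nz => ->; rewrite mul0r.
Qed.

Lemma Cc_tensor b (u : X -> C) : alg b -> Cc_obj u -> Cc (group_tensor (hX := hX) (lcX := lcX) b u).
Proof.
move=> fb [uc uK]; split.
  apply: tarr_continuous => g z.
  by apply: (@cvgM _ _ (nbhs z) _ (fun=> extend b g) u); [exact: cvg_cst|exact: uc].
pose S : set (discrete_topology Gam) := (@iso_gam _ _ hX lcX a x) @` [set s | b s != 0].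
apply: (@compact_support_sub _ _ (S `*` closure [set z | u z != 0])).
- exact: tarr_hausdorff.
- apply: compact_setX => //; apply: finite_compact; exact: finite_image.
move=> [g z]; rewrite /group_tensor /= => nz; split=> /=.
  have [s gs] : exists s : Iso, g = iso_gam s by apply: (extend_supp (b := b)); apply: contraNneq nz => ->; rewrite mul0r.
  exists s => //=; apply: contraNneq nz => bs.
  by rewrite gs extend_iso bs mul0r.
by apply: subset_closure => /=; apply: contraNneq nz => ->; rewrite mulr0.
Qed.

Lemma ginvK (g : arr G) : ginv (ginv g) = g.
Proof. by case: g => g y /=; rewrite /tinv /= invgK actK. Qed.

Lemma Cc_gstar f : Cc f -> Cc (gstar (R := R) (G := G) f).
Proof.
move=> [fc fK]; split.
  move=> p A hA.
  exact: (@ginv_cont G p _ (fc (ginv p) _ (conj_continuous hA))).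
apply: (@compact_support_sub _ _ (@ginv G @` closure [set g | f g != 0])).
- exact: tarr_hausdorff.
- by apply: continuous_compact => //; apply: continuous_subspaceT; exact: ginv_cont.
move=> p /= np; exists (ginv p); last exact: ginvK.
by apply: subset_closure => /=; apply: contraNneq np; rewrite /gstar => ->; rewrite rmorph0.
Qed.

(** A compact set meets finitely many of the open sets {g} x X. *)
Lemma compact_finite_gam (K : set (arr G)) : compact K ->
  exists2 S : set Gam, finite_set S & forall p, K p -> S p.1.
Proof.
move=> /compact_near_coveringP cov.
pose F := filter_from (@finite_set Gam) (fun S0 => [set S : set Gam | S0 `<=` S]).
have FF : Filter F.
  apply: filter_from_filter; first by exists set0.
  move=> S S' fS fS'; exists (S `|` S'); first by rewrite finite_setU.
  by move=> T SST; split=> t St; apply: SST; [left|right].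
have [|S0 fS0 hS0] := cov _ F (fun S p => S p.1) FF; last first.
  by exists S0 => //; exact: hS0.
move=> p _; exists ([set q : arr G | q.1 = p.1], [set S : set Gam | [set p.1 : Gam] `<=` S]).
  split; last by exists [set p.1 : Gam] => //; exact: finite_set1.
  by apply/tarr_nbhs => /=; exact: nearW.
by move=> [q S] /= [-> pS]; apply: pS.
Qed.

Lemma Cc_fiber f (z : X) : Cc f -> finite_set [set h : arr G | tgt h = z /\ (f : arr G -> C) h != 0].
Proof.
move=> [_ /compact_finite_gam[S fS hS]].
apply: (@sub_finite_set _ _ ((fun g : Gam => (g, a g^-1%g z) : arr G) @` S)).
  move=> [g y] [/= gz fz]; exists g; first by have := hS (g, y); apply; exact: subset_closure.
  by rewrite -gz /ttgt /= actK.
exact: finite_image.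
Qed.

Lemma extend_star b g : extend (b^°) g = (extend b g^-1%g)^*.
Proof.
rewrite /extend; case: pselect => gx; case: pselect => gx'.
- by congr (_^*); congr b; exact/iso_gam_inj.
- by case: gx'; rewrite -{1}gx actK.
- by case: gx; rewrite -{1}gx' -{1}[g]invgK actK.
- by rewrite rmorph0.
Qed.

(** In (b'(x)u')* (b(x)u) the points at which [u] is evaluated depend on the source
only and those of [u'] on the target only, whatever the stabilizer element
summed over. This is where the product structure of the groupoid enters: it
yields the covariance of b |-> pi(b (x) u)v for all [u], invariant or not. *)
Lemma conv_gstar_tensor b b' (u u' : X -> C) :
  Defs.conv (gstar (group_tensor (hX := hX) (lcX := lcX) b' u')) (group_tensor b u) =
  fun p : arr G => (u' (tgt p))^* * group_tensor (b'^° ** b) u p.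
Proof.
apply/funext => p; rewrite /Defs.conv.
rewrite (eq_fsbigr (fun h : arr G => (extend (b'^°) h.1 : C) *:
    (((u' (tgt p))^* * group_tensor b u (gmul (ginv h) p)) : C^o))); last first.
  move=> [k w] /set_mem /= hp; rewrite extend_star /gstar /group_tensor /= rmorphM /=.
  by rewrite -[a k w]/(ttgt a (k, w)) hp -!mulrA.
rewrite extend_sum; case: p => g y /=.
have [[t ->]|ngx] := pselect (exists t : Iso, g = iso_gam t).
  rewrite {2}/group_tensor /= extend_iso group_convE /group_sum mulr_fsuml mulr_fsumr.
  apply: eq_fsbigr => s _.
  rewrite /group_tensor /= -[((iso_gam s)^-1 * iso_gam t)%g]/(iso_gam (s^-1 * t)%g) extend_iso.
  set A := group_star b' s; set U := (u' _)^*.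
  by change (A * (U * (b (s^-1 * t)%g * u y)) = U * (A * b (s^-1 * t)%g * u y)); ring.
have extend0 (c : Iso -> C) (k : Iso) : extend (hX := hX) (lcX := lcX) (x := x) c ((iso_gam k)^-1 * g)%g = 0.
  apply/eqP/negPn/negP => /extend_supp[s hs]; apply: ngx; exists (k * (s : Iso))%g.
  by rewrite iso_gamM -hs mulVKg.
have -> : group_tensor (b'^° ** b) u (g, y) = 0.
  by have := extend0 (b'^° ** b) 1%g; rewrite iso_gam1 invg1 mul1g /group_tensor /= => ->; rewrite mul0r.
rewrite mulr0 /group_sum fsbig1 // => s _.
by rewrite /group_tensor /= extend0 mul0r mulr0 scaler0.
Qed.

Section StarRep.
Context (H : hilbertType R) (pi : (arr G -> C) -> H -> H).
Hypothesis hpi : star_rep (@Cc R G) (@Defs.conv R G) (@gstar R G) pi.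
Local Notation tensor := (@group_tensor R Gam X hX lcX a x).

Lemma tensor_lin (z : C) b1 b2 u :
  tensor (fun t => z * b1 t + b2 t) u = fun p => z * tensor b1 u p + tensor b2 u p.
Proof.
apply/funext => -[g y]; rewrite /group_tensor /= mulrA -mulrDl; congr (_ * _).
by rewrite /extend; case: pselect => // _; rewrite mulr0 addr0.
Qed.

Lemma tensor_covariant (u : X -> C) v : Cc_obj u -> covariant (fun b => pi (tensor b u) v).
Proof.
move=> hu; split=> [z b1 b2 f1 f2|b c c' fb fc fc'].
  by rewrite tensor_lin (rep_linear hpi) //; exact: Cc_tensor.
have fbs := group_alg_star fb.
have Cb : Cc (tensor c u) by exact: Cc_tensor.
have Cbc : Cc (tensor (b ** c) u) by apply: Cc_tensor => //; exact: group_alg_conv.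
have Cbc' : Cc (tensor (b^° ** c') u) by apply: Cc_tensor => //; exact: group_alg_conv.
rewrite !(rep_star hpi) // -!(rep_mul hpi) //; try exact: Cc_gstar; try exact: Cc_tensor.
by rewrite !conv_gstar_tensor star_conv // convA //; exact: group_alg_star.
Qed.

Lemma tensor_delta1 (u : X -> C) (g : Gam) y : tensor (delta 1%g) u (g, y) = (g == 1%g)%:R * u y.
Proof.
rewrite /group_tensor /=; congr (_ * _).
have [->|g1] := eqVneq g 1%g; first by rewrite -(iso_gam1 hX lcX a x) extend_iso /dirac_fun eqxx.
apply/eqP/negPn/negP => nz; have [s gs] := extend_supp nz; move: nz.
rewrite gs extend_iso /dirac_fun; have [s1|_] := eqVneq s 1%g; last by rewrite eqxx.
by move: g1; rewrite gs s1 eqxx.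
Qed.

Lemma rnormB_sqr (v w : H) :
  rnorm (v - w) ^+ 2 = rnorm v ^+ 2 + rnorm w ^+ 2 - 2 * complex.Re (hdot H v w).
Proof.
have := dnormB (hdot H) v w; rewrite /= !hdot_rnorm => /(congr1 (@complex.Re R)).
rewrite !raddfB !raddfD /=.
have -> : complex.Re (hdot H v w)^* = complex.Re (hdot H v w) by case: (hdot H v w).
by move=> ->; ring.
Qed.

(** 1 - u^2 = (1-w)^2, so that |v|^2 - |pi(u)v|^2 = |v - pi(w)v|^2. Writing 1 - u^2
as the square of 1 minus a compactly supported function avoids extending pi to
the unitization. *)
Lemma tensor_contraction (u w : X -> R) v :
  Cc_obj (fun z => (u z)%:C%C) -> Cc_obj (fun z => (w z)%:C%C) ->
  (forall z, u z ^+ 2 = 2 * w z - w z ^+ 2) ->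
  rnorm (pi (tensor (delta 1%g) (fun z => (u z)%:C%C)) v) <= rnorm v.
Proof.
move=> hu hw uw; have f1 := group_alg_dirac R (1%g : Iso).
pose U := tensor (delta 1%g) (fun z => (u z)%:C%C).
pose W := tensor (delta 1%g) (fun z => (w z)%:C%C).
have CU : Cc U by exact: Cc_tensor.
have CW : Cc W by exact: Cc_tensor.
have CU' := Cc_gstar CU; have CW' := Cc_gstar CW.
have sq (r : X -> R) p : Defs.conv (gstar (tensor (delta 1%g) (fun z => (r z)%:C%C)))
    (tensor (delta 1%g) (fun z => (r z)%:C%C)) p = tensor (delta 1%g) (fun z => (r z ^+ 2)%:C%C) p.
  rewrite conv_gstar_tensor star_dirac invg1 conv1l; case: p => g y.
  rewrite !tensor_delta1 /=; have [->|_] := eqVneq g 1%g; last by rewrite !mul0r mulr0.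
  by rewrite /ttgt /= act1 !mul1r conj_Creal ?complex_real // -rmorphM -expr2.
pose W2 := tensor (delta 1%g) (fun z => (w z ^+ 2)%:C%C).
have CW2 : Cc W2.
  apply: Cc_tensor => //; rewrite (_ : (fun z => _) = fun z => (w z)%:C%C * (w z)%:C%C).
    exact: Cc_objM.
  by apply/funext => z; rewrite expr2 rmorphM.
have EW : (rnorm (pi W v) ^+ 2)%:C%C = hdot H v (pi W2 v).
  by rewrite -hdot_rnorm (rep_star hpi) // -(rep_mul hpi) // (funext (sq w)).
pose W' := tensor (fun t => 1 * delta 1%g t + delta 1%g t) (fun z => (w z)%:C%C).
have CW'' : Cc W' by apply: Cc_tensor => //; exact: group_algP.
have EW' : pi W' v = pi W v + pi W v.
  by rewrite /W' tensor_lin (rep_linear hpi) // scale1r.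
have : (rnorm (pi U v) ^+ 2)%:C%C = hdot H v (pi (fun p => -1 * W2 p + W' p) v).
  rewrite -hdot_rnorm (rep_star hpi) // -(rep_mul hpi) // (funext (sq u)); congr (hdot H v (pi _ v)).
  apply/funext => -[g y]; rewrite mulN1r /W' tensor_lin /W2 !tensor_delta1 uw rmorphB rmorphM /=.
  by rewrite (_ : 2%:C%C = 2) ?rmorph_nat //; ring.
rewrite (rep_linear hpi) // EW' scaleN1r linearDr linearDr linearNr /= -EW.
move=> /(congr1 (@complex.Re R)); rewrite /= !raddfD raddfN /= => EU.
rewrite -(@ler_pXn2r _ 2) ?nnegrE ?rnorm_ge0 // -subr_ge0.
suff -> : rnorm v ^+ 2 - rnorm (pi U v) ^+ 2 = rnorm (v - pi W v) ^+ 2 by exact: sqr_ge0.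
by rewrite rnormB_sqr EU; ring.
Qed.

End StarRep.

End CcTensor.

(** * Bump functions, and elementary facts on the norms *)

Section Bump.
Context (R : realType) (X : topologicalType) (hX : hausdorff_space X)
  (lcX : locally_compact [set: X]) (x : X).

Lemma ofreal_continuous : continuous (fun r : R => r%:C%C : R[i]^o).
Proof.
move=> r A /= /nbhs_normP[e e0 hA]; apply/nbhs_normP; exists (complex.Re e).
  by rewrite /= -ltcR RRe_real // gtr0_real.
move=> s /= rs; apply: hA; rewrite /= -rmorphB normc_def /= expr0n addr0 sqrtr_sqr.
by rewrite -[e]RRe_real ?gtr0_real // ltcR.
Qed.

Lemma exists_compact_bump : exists s : X -> R,
  [/\ continuous s, s x = 1 & compact (closure [set z | s z != 0])].
Proof.
have [U nU [cU clU]] := @lcX x Logic.I.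
have nU' : nbhs x U by move: nU; rewrite within_setT.
have clB : closed (~` U°) by apply: open_closedC; exact: open_interior.
have [|f [fc _ f0 f1]] := (uniform_separatorP (R := R) [set x] (~` U°)).1 _.
  by apply: (locally_compact_completely_regular (R := R)) => //; exact.
exists (fun z => 1 - f z); split.
- by move=> z; apply: cvgB; [exact: cvg_cst|exact: fc].
- by rewrite (f0 (f x)) ?subr0 //; exists x.
apply: (@compact_support_sub _ _ U) => // z /= nz.
have [/interior_subset//|nUz] := pselect (U° z).
by move: nz; rewrite (f1 (f z)) ?subrr ?eqxx //; exists z.
Qed.

Lemma Cc_obj_real (s : X -> R) (g : R -> R) : continuous s -> continuous g -> g 0 = 0 ->
  compact (closure [set z | s z != 0]) -> Cc_obj (fun z => (g (s z))%:C%C).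
Proof.
move=> sc gc g0 sK; split.
  move=> z; apply: (@continuous_comp _ _ _ (g \o s) (fun r : R => r%:C%C : R[i]^o)).
    exact: (continuous_comp (sc z) (gc (s z))).
  exact: ofreal_continuous.
apply: (compact_support_sub hX sK) => z /= nz; apply: subset_closure => /=.
by apply: contraNneq nz => ->; rewrite g0.
Qed.

(** From a bump function s, take u = 2s/(1+s^2) and w = 2s^2/(1+s^2): then 1 - w =
(1-s^2)/(1+s^2), so that u^2 + (1-w)^2 = 1, and all functions are rational
in s. *)
Lemma exists_unit_bump : exists u w : X -> R,
  [/\ Cc_obj (fun z => (u z)%:C%C), Cc_obj (fun z => (w z)%:C%C), u x = 1,
      forall z, rnorm ((u z)%:C%C : R[i]^o) <= 1 & forall z, u z ^+ 2 = 2 * w z - w z ^+ 2].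
Proof.
have [s [sc sx sK]] := exists_compact_bump.
have d0 (t : R) : 1 + t ^+ 2 != 0 by rewrite gt_eqF // ltr_pwDl // sqr_ge0.
have sqc : continuous (fun t : R => t ^+ 2) by exact: exprn_continuous.
have dc : continuous (fun t : R => (1 + t ^+ 2)^-1).
  by move=> t; apply: cvgV => //; apply: cvgD; [exact: cvg_cst|exact: sqc].
exists (fun z => 2 * s z * (1 + s z ^+ 2)^-1), (fun z => 2 * s z ^+ 2 * (1 + s z ^+ 2)^-1); split.
- apply: (@Cc_obj_real s (fun t => 2 * t * (1 + t ^+ 2)^-1)) => //; last by rewrite mulr0 mul0r.
  by move=> t; apply: cvgM; [apply: cvgM; [exact: cvg_cst|exact: cvg_id]|exact: dc].
- apply: (@Cc_obj_real s (fun t => 2 * t ^+ 2 * (1 + t ^+ 2)^-1)) => //; last by rewrite expr0n mulr0 mul0r.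
  by move=> t; apply: cvgM; [apply: cvgM; [exact: cvg_cst|exact: sqc]|exact: dc].
- by rewrite sx expr1n; field.
- move=> z; rewrite -(@ler_pXn2r _ 2) ?nnegrE ?rnorm_ge0 // rnorm_sqr /= expr0n addr0 expr1n.
  rewrite exprMn exprVn ler_pdivrMr ?exprn_gt0 // ?mul1r; last by rewrite ltr_pwDl // sqr_ge0.
  by rewrite -subr_ge0 (_ : _ - _ = (1 - s z ^+ 2) ^+ 2) ?sqr_ge0 //; ring.
- by move=> z; field; exact: d0.
Qed.

End Bump.

(** Convergence to 0 of nonnegative extended reals that may be infinite at first. *)
Lemma cvge0P (R : realType) (f : nat -> \bar R) : (forall n, (0 <= f n)%E) ->
  (f n @[n --> \oo] --> 0%E <->
   forall e : R, 0 < e -> exists n0, forall n, (n0 <= n)%N -> (f n <= e%:E)%E).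
Proof.
move=> f0; split=> [fc e e0|h].
  have : nbhs 0%E [set y : \bar R | (y < e%:E)%E].
    by apply: open_nbhs_nbhs; split; [exact: open_ereal_lt_ereal|rewrite /= lte_fin].
  by move=> /fc[n0 _ hn0]; exists n0 => n nn; apply/ltW; exact: hn0.
apply/fine_cvgP; split.
  have [n0 hn0] := h 1 ltr01; exists n0 => // n /= nn.
  by rewrite ge0_fin_numE // (le_lt_trans (hn0 n nn)) // ltry.
apply/cvgrPdist_le => e e0; have [n0 hn0] := h e e0; exists n0 => // n /= nn.
have fn := hn0 n nn; rewrite sub0r normrN ger0_norm ?fine_ge0 //.
by rewrite -lee_fin fineK // ge0_fin_numE // (le_lt_trans fn) // ltry.
Qed.

Lemma l2norm_ge0 (R : realType) (I : choiceType) (A : set I) (V : normedModType R[i]) (xi : I -> V) :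
  (0 <= l2norm A xi)%E.
Proof. exact: sqrte_ge0. Qed.

Lemma opnorm_ge0 (R : realType) (E : Type) (D : set E) (N : E -> \bar R) (T : E -> E) (v : E) :
  (forall w, 0 <= N w)%E -> D v -> (N v <= 1)%E -> (0 <= opnorm D N T)%E.
Proof.
move=> N0 Dv Nv; apply: le_trans (N0 (T v)) _.
by apply: ereal_sup_ubound; exists v.
Qed.

Lemma l2norm0 (R : realType) (I : choiceType) (A : set I) (V : normedModType R[i]) :
  l2norm A (fun=> 0 : V) = 0%E.
Proof. by rewrite /l2norm esum1 ?sqrte0 // => i _; rewrite rnorm0 expr0n. Qed.

Lemma reduced_norm_ge0 (R : realType) (G : etale_groupoid) (x : obj G) (f : arr G -> R[i]) :
  (0 <= reduced_norm f)%E.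
Proof.
apply: (@le_trans _ _ (opnorm (l2_fiber x) (fun eta => l2norm (src_fiber x) (eta : arr G -> R[i]^o))
    (regular_op x f))); last by apply: ereal_sup_ubound; exists x.
apply: (@opnorm_ge0 _ _ _ _ _ (fun=> 0)); rewrite ?l2norm0 //.
  by move=> w; exact: l2norm_ge0.
by split=> //; rewrite l2norm0.
Qed.

Lemma ind_opnorm_ge0 (R : realType) (G : etale_groupoid) (x : obj G) (H : hilbertType R)
    (rho : (isotropy x -> R[i]) -> H -> H) (f : arr G -> R[i]) :
  group_rep rho -> (0 <= ind_opnorm rho f)%E.
Proof.
move=> hr; apply: (@opnorm_ge0 _ _ _ _ _ (fun=> 0)); rewrite /ind_norm ?l2norm0 //.
  by move=> w; exact: l2norm_ge0.
split=> // [g h _|]; last by rewrite /ind_norm l2norm0.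
by rewrite (linear_map0 (rep_op_linear hr (group_alg_star (group_alg_dirac R h)))).
Qed.

Section ReducedNormIso.
Context (R : realType) (L L' : groupType) (phi : L' -> L).
Hypothesis phi_bij : bijective phi.
Hypothesis phiM : forall g h, phi (g * h)%g = (phi g * phi h)%g.

Lemma group_iso1 : phi 1%g = 1%g.
Proof. by apply: (@mulgI _ (phi 1%g)); rewrite -phiM !mulg1. Qed.

Lemma group_isoV g : phi g^-1%g = (phi g)^-1%g.
Proof. by apply: (@mulgI _ (phi g)); rewrite -phiM !mulgV group_iso1. Qed.

Lemma group_conv_iso (a xi : L -> R[i]) : group_conv (a \o phi) (xi \o phi) = group_conv a xi \o phi.
Proof.
apply/funext => g; rewrite /group_conv /=.
rewrite (reindex_fsbig phi [set: L'] [set: L]); last by rewrite setTT_bijective.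
by apply: eq_fsbigr => h _; rewrite /= phiM group_isoV.
Qed.

Lemma l2norm_iso (xi : L -> R[i]^o) : l2norm [set: L'] (xi \o phi : L' -> R[i]^o) = l2norm [set: L] xi.
Proof.
congr sqrte; symmetry; apply: reindex_esum; by rewrite setTT_bijective.
Qed.

Lemma group_reduced_norm_iso (a : L -> R[i]) :
  group_reduced_norm a = group_reduced_norm (a \o phi).
Proof.
have [psi K1 K2] := phi_bij.
congr ereal_sup; apply/seteqP; split=> _ [xi [xf x1] <-].
  by exists (xi \o phi); rewrite /= ?group_conv_iso !l2norm_iso.
have E : xi = (xi \o psi) \o phi by apply/funext => g /=; rewrite K1.
exists (xi \o psi); first by split; rewrite /= -(l2norm_iso (xi \o psi)) -E.
by rewrite -l2norm_iso -group_conv_iso -E.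
Qed.

End ReducedNormIso.

(** * Comparison of the two norms *)

Lemma left_reg_le_reduced (R : realType) (L : groupType) (a : L -> R[i]) (r : R) : group_alg a ->
  (group_reduced_norm a <= r%:E)%E -> forall w : l2 R L, l2n (left_reg a w) <= r * l2n w.
Proof.
move=> fa ar w; have ll := left_reg_linear fa.
have [/l2n_eq0->|w0] := eqVneq (l2n w) 0.
  by rewrite (linear_map0 ll) -!l2_rnormE rnorm0 mulr0.
have wp : 0 < l2n w by rewrite lt0r w0 l2n_ge0.
have ip : 0 <= (l2n w)^-1 by rewrite invr_ge0 ltW.
pose w' := (l2n w)^-1%:C%C *: w.
have w'1 : l2n w' = 1.
  by rewrite l2nZ rnormR // mulVf.
have : ((l2n (left_reg a w'))%:E <= r%:E)%E.
  apply: le_trans ar; rewrite -opnorm_left_reg //; apply: ereal_sup_ubound.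
  by exists w' => //; split=> //; rewrite /hnorm l2_rnormE w'1.
rewrite lee_fin (linear_mapZ ll) l2nZ rnormR //.
by rewrite -ler_pdivrMr // mulrC.
Qed.

Section Main.
Context (R : realType) (Gam : groupType) (X : topologicalType)
  (hX : hausdorff_space X) (lcX : locally_compact [set: X])
  (a : homeo_action Gam X) (x : X).
Local Notation C := R[i].
Local Notation G := (transformation_groupoid a hX lcX).
Local Notation Iso := (@isotropy G x).
Local Notation tensor := (@group_tensor R Gam X hX lcX a x).

Lemma reduced_le_e_norm (h : Iso -> C) : group_alg h ->
  (group_reduced_norm h <= @e_norm R G x h)%E.
Proof.
move=> fh; rewrite -opnorm_left_reg //; apply: ereal_sup_ubound.
exists (l2_space R Iso), (@left_reg R Iso); split=> //; first exact: left_reg_group_rep.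
move=> f [fC _]; have hr := left_reg_group_rep R Iso.
move=> /(cvge0P (fun n => @reduced_norm_ge0 R G x (f n))) hf.
apply/(cvge0P (fun n => ind_opnorm_ge0 (f n) hr)) => e e0.
have [n0 hn0] := hf e e0; exists n0 => n nn; apply: le_trans (hn0 n nn).
by apply: ind_opnorm_left_reg_le => z; exact: Cc_fiber.
Qed.

Section Upper.
Context (h : Iso -> C) (fh : group_alg h) (r : R) (r0 : 0 < r)
  (hr : (group_reduced_norm h <= r%:E)%E).
Context (N : R) (N0 : 0 <= N).
Hypothesis hN : forall (H : hilbertType R) (Phi : (Iso -> C) -> H), covariant Phi ->
  forall b, group_alg b -> rnorm (Phi (group_conv h b)) <= N * rnorm (Phi b).

Let M := N ^+ 2 + r ^+ 2.
Let c := r ^+ 2 / M.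

Let r20 : 0 < r ^+ 2. Proof. exact: exprn_gt0. Qed.
Let M0 : 0 < M. Proof. by rewrite /M ltr_wpDl // sqr_ge0. Qed.
Let c0 : 0 < c. Proof. exact: divr_gt0. Qed.
Let c1 : c <= 1. Proof. by rewrite ler_pdivrMr // mul1r lerDr sqr_ge0. Qed.
Let cM : c * M = r ^+ 2. Proof. by rewrite divfK // gt_eqF. Qed.

Local Notation tn := (trunc_alg h M c).

Let tn_alg n : group_alg (tn n). Proof. exact: group_alg_trunc. Qed.

Lemma covariant_le_M (H : hilbertType R) (Phi : (Iso -> C) -> H) : covariant Phi ->
  forall b, group_alg b -> rnorm (Phi (group_conv h b)) ^+ 2 <= M * rnorm (Phi b) ^+ 2.
Proof.
move=> covP b fb; apply: (@le_trans _ _ ((N * rnorm (Phi b)) ^+ 2)).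
  by rewrite ler_pXn2r ?nnegrE ?mulr_ge0 ?rnorm_ge0 // hN.
by rewrite exprMn ler_wpM2r ?sqr_ge0 // lerDl ltW.
Qed.

Variables (u w : X -> R).
Hypotheses (hu : Cc_obj (fun z => (u z)%:C%C)) (hw : Cc_obj (fun z => (w z)%:C%C))
  (ux : u x = 1) (u1 : forall z, rnorm ((u z)%:C%C : C^o) <= 1)
  (uw : forall z, u z ^+ 2 = 2 * w z - w z ^+ 2).

Let F n := tensor (tn n) (fun z => (u z)%:C%C).

Lemma large_index (e : R) : 0 < e -> exists n0, forall n, (n0 <= n)%N -> n.+1%:R^-1 <= e ^+ 2.
Proof.
move=> e0; have e2 : 0 < e ^+ 2 by exact: exprn_gt0.
exists (Num.truncn (e ^+ 2)^-1) => n nn.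
rewrite -[leRHS]invrK lef_pV2 ?posrE ?invr_gt0 //.
apply: ltW; apply: lt_le_trans (truncnS_gt _) _.
by rewrite ler_nat ltnS.
Qed.

(** The uniform estimate of b_m - b_n holds for the covariant map b |-> pi(b (x) u)v,
whose value at the unit has norm at most that of [v]. *)
Lemma truncation_full_cauchy : full_cauchy F.
Proof.
split=> [n|e e0]; first exact: Cc_tensor.
have [n0 hn0] := large_index e0; exists n0 => m n hm hn.
apply: ge_ereal_sup => _ [H [pi [hpi ->]]].
apply: ge_ereal_sup => _ [v [_ v1] <-]; rewrite /hnorm lee_fin.
have cov := tensor_covariant x hpi v hu.
have -> : (fun g : arr G => F m g - F n g) =
    tensor (fun t => -1 * tn n t + tn m t) (fun z => (u z)%:C%C).
  by rewrite tensor_lin; apply/funext => g; rewrite mulN1r addrC.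
have -> : (fun t => -1 * tn n t + tn m t) = fun t => tn m t - tn n t.
  by apply/funext => t; rewrite mulN1r addrC.
have le1 := trunc_alg_close fh c M0 cov (covariant_le_M cov) e0 (hn0 m hm) (hn0 n hn).
apply: le_trans le1 _.
rewrite -[leRHS]mulr1 ler_pM2l //.
apply: le_trans (tensor_contraction x hpi v hu hw uw) _.
by rewrite /hnorm lee_fin in v1.
Qed.

(** In the regular representation a*a/M is at most c, where the truncation
vanishes. *)
Lemma truncation_reduced_cvg0 : reduced_norm (F n) @[n --> \oo] --> 0%E.
Proof.
apply/(cvge0P (fun n => @reduced_norm_ge0 R G x (F n))) => e e0.
have [n0 hn0] := large_index e0; exists n0 => n nn.
apply: reduced_norm_tensor => //; first exact: ltW.
move=> v; have cov := left_reg_covariant v.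
have := trunc_alg_small fh M0 c0 c1 cov (covariant_le_M cov) e0 (hn0 n nn).
rewrite left_reg1; apply => b fb; rewrite cM left_reg_mul // -exprMn.
have r0' := ltW r0; rewrite ler_pXn2r ?nnegrE ?mulr_ge0 ?rnorm_ge0 //.
exact: (left_reg_le_reduced fh hr).
Qed.

(** Otherwise rho(b_n)v stays away from 0, and with it Ind rho of the truncations. *)
Lemma rep_le_of_factors (H : hilbertType R) (rho : (Iso -> C) -> H -> H) (v : H) :
  group_rep rho -> factors_through_reduced (ind_opnorm rho) -> rnorm v <= 1 ->
  rnorm (rho h v) <= r.
Proof.
move=> hrho fac v1; rewrite leNgt; apply/negP => rv.
have := fac F truncation_full_cauchy truncation_reduced_cvg0.
move=> /(cvge0P (fun n => ind_opnorm_ge0 (F n) hrho)) small.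
pose d := M^-1 * (rnorm (rho h v) ^+ 2 - r ^+ 2).
have d0 : 0 < d.
  by rewrite mulr_gt0 ?invr_gt0 // subr_gt0 ltr_pXn2r ?nnegrE ?rnorm_ge0 // ltW.
have d20 : 0 < d / 2 by rewrite divr_gt0.
have [n0 /(_ n0 (leqnn _))] := small _ d20.
have ux' : (u x)%:C%C = 1 by rewrite ux.
move=> /(le_trans (ind_opnorm_tensor_ge hrho v1 (tn_alg n0) ux')).
rewrite lee_fin => le1.
have cov := group_rep_covariant v hrho.
have := trunc_alg_large fh c M0 cov (covariant_le_M cov) n0.
set t := rnorm (rho (dirac_fun R 1%g) v).
have t1 : t <= 1 by exact: le_trans (group_rep_one v hrho) v1.
have t0 : 0 <= t by exact: rnorm_ge0.
set y := rnorm (rho (trunc_alg h M c n0) v) in le1 *.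
have y0 : 0 <= y by exact: rnorm_ge0.
(* With t the norm of rho(1)v and y that of rho(b_n)v, [trunc_alg_large] bounds
   y >= y t from below by |rho(a)v|^2/M - c t^2 >= d, whereas y <= d/2. *)
have cE : c = M^-1 * r ^+ 2 by rewrite /c mulrC.
have : y * t <= y by rewrite ler_piMr.
have : c * t ^+ 2 <= c by rewrite ler_piMr ?(ltW c0) // exprn_ile1.
by move: d0 le1; rewrite /d mulrBr -cE; lra.
Qed.

End Upper.

(** A vector violating the inequality leaves room for a real number r strictly
between the two norms. *)
Lemma e_norm_le_reduced (h : Iso -> C) : group_alg h ->
  (@e_norm R G x h <= group_reduced_norm h)%E.
Proof.
move=> fh; apply: ge_ereal_sup => _ [H [rho [hrho fac ->]]].
apply: ge_ereal_sup => _ [v [_ v1] <-]; rewrite leNgt; apply/negP => lt.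
have g0 : (0 <= group_reduced_norm h)%E.
  rewrite /group_reduced_norm.
  apply: (@opnorm_ge0 _ _ _ _ _ (fun=> 0)); rewrite /= ?l2norm0 //.
  by move=> xi; exact: l2norm_ge0.
have gfin : group_reduced_norm h \is a fin_num.
  by rewrite ge0_fin_numE // (lt_trans lt) // ltry.
rewrite -(fineK gfin) /hnorm lte_fin in lt.
have gf0 : 0 <= fine (group_reduced_norm h) by exact: fine_ge0.
pose r := (fine (group_reduced_norm h) + rnorm (rho h v)) / 2.
have rp : 0 < r by rewrite /r; lra.
have hr : (group_reduced_norm h <= r%:E)%E.
  by rewrite -(fineK gfin) lee_fin /r; lra.
have [N [N0 hN]] := cov_bound fh.
have [u [w [hu hw ux u1 uw]]] := @exists_unit_bump R X hX lcX x.
have := rep_le_of_factors fh rp hr N0 hN hu hw ux u1 uw hrho fac v1.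
by rewrite /r; lra.
Qed.

End Main.

Theorem proposition2p10 (R : realType) (Gam : groupType) (X : topologicalType)
    (hX : hausdorff_space X) (lcX : locally_compact [set: X])
    (a : homeo_action Gam X) (x : X) :
  let G := transformation_groupoid a hX lcX in
  forall h : @isotropy G x -> R[i], group_alg h ->
    @e_norm R G x h = group_reduced_norm h /\
    @e_norm R G x h = group_reduced_norm (h \o @stab_isotropy Gam X a x hX lcX).
Proof.
move=> G h fh.
have E : @e_norm R G x h = group_reduced_norm h.
  by apply/eqP; rewrite eq_le e_norm_le_reduced ?reduced_le_e_norm.
split=> //; rewrite E; apply: group_reduced_norm_iso.
  exact: stab_isotropy_bij.
exact: stab_isotropyM.
Qed.
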